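(* Let $\mathfrak g=\mathfrak{su}(2)$ and let $M_o$ be equipped with the hyper-Lie Poisson structure $\{\pi_{\mathcal F}\}$ determined by $$A(a,b,c)=\frac1{\Phi(a,b,c)}\big([a,b]\otimes[a,b]+[b,c]\otimes[b,c]+[c,a]\otimes[c,a]\big),\qquad \Phi(a,b,c)=\langle a,[b,c]\rangle .$$ Then each hypersymplectic leaf of $M_o$ is a 4-dimensional hyperkähler manifold.
   Context: $\mathfrak g=\mathfrak{su}(2)$ carries an Ad-invariant positive-definite inner product $\langle\cdot,\cdot\rangle$ (a multiple of the Killing form), used to identify $\mathfrak g^*$ with $\mathfrak g$. $M=L(\mathfrak g,\mathfrak{su}(2))$ is the space of linear maps, where the target is regarded as an oriented Euclidean space. A frame is an orthonormal basis $\mathcal F=\{e_1,e_2,e_3\}$ of the target (of a fixed orientation); $\mathcal F_1=\mathcal F$, $\mathcal F_2=\{e_2,e_3,e_1\}$, $\mathcal F_3=\{e_3,e_1,e_2\}$. It identifies $M$ with $\mathfrak g\times\mathfrak g\times\mathfrak g$ via $\Psi_{\mathcal F}:\phi\mapsto(a,b,c)$, $\phi(x)=\langle a,x\rangle e_1+\langle b,x\rangle e_2+\langle c,x\rangle e_3$. $M_o=\{\Phi\neq0\}$; $\Phi$ and $A$ are independent of the frame. $A_{\xi,\eta}$ is the contraction of $A\in S^2(\mathfrak g)$ with $\xi,\eta\in\mathfrak g$. With $l^1_\xi(a,b,c)=\langle\xi,a\rangle$, $l^2_\xi(a,b,c)=\langle\xi,b\rangle$, $l^3_\xi(a,b,c)=\langle\xi,c\rangle$,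 $\pi_{\mathcal F}$ is the Poisson structure on $M_o$ whose bracket, under $\Psi_{\mathcal F}$, is $$\{l^1_\xi,l^1_\eta\}=l^1_{[\xi,\eta]},\quad \{l^1_\xi,l^2_\eta\}=\{l^2_\xi,l^1_\eta\}=l^2_{[\xi,\eta]},\quad \{l^2_\xi,l^2_\eta\}=-l^1_{[\xi,\eta]},$$ $$\{l^1_\xi,l^3_\eta\}=\{l^3_\xi,l^1_\eta\}=l^3_{[\xi,\eta]},\quad \{l^3_\xi,l^3_\eta\}=-l^1_{[\xi,\eta]},\quad \{l^2_\xi,l^3_\eta\}=-\{l^3_\xi,l^2_\eta\}=A_{\xi,\eta}.$$ The symplectic leaves of the $\pi_{\mathcal F}$ do not depend on $\mathcal F$ and are called hypersymplectic leaves. On a leaf $S$, let $\omega_i$ be the symplectic form induced by $\pi_{\mathcal F_i}$ and $\omega_i^b:TS\to T^*S$, $v\mapsto\omega_i(v,\cdot)$; then $\omega_1e_1+\omega_2e_2+\omega_3e_3$ is hypersymplectic, meaning equivalently that $[\omega_i^b(\omega_j^b)^{-1}]^2=-1$ for $i\ne j$. The associated pseudo-metric is $g=\omega_3^b(\omega_1^b)^{-1}\omega_2^b$, with $I=g^{-1}\omega_1^b$, $J=g^{-1}\omega_2^b$, $K=g^{-1}\omega_3^b$. The hypersymplectic structure is called hyperkähler if $g$ is positive definite or negative definite. *)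

(* Defs.v *)
From HB Require Import structures.
From mathcomp Require Import all_boot all_order all_algebra.
From mathcomp Require Import complex ring lra.
From mathcomp Require Import all_classical all_reals all_analysis.
From Stdlib Require Export Relation_Operators.

Set Implicit Arguments.
Unset Strict Implicit.
Unset Printing Implicit Defensive.

Import Order.TTheory GRing.Theory Num.Theory.
Import numFieldNormedType.Exports.

Local Open Scope classical_set_scope.
Local Open Scope ring_scope.

Section Smooth.
Context {R : realType}.

(* The maps of class C^k on U; they have the usual meaning for open U. *)
Fixpoint Ck (V W : normedModType R) (k : nat) (U : set V) (f : V -> W) : Prop :=
  match k with
  | 0 => forall x, U x -> {for x, continuous f}
  | k'.+1 => (forall x, U x -> differentiable f x) /\
             (forall v, Ck k' U (fun x => 'D_v f x))
  end.

Definition smooth_on (V W : normedModType R) (U : set V) (f : V -> W) : Prop :=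
  forall k, Ck k U f.

(* A countable atlas (U k, psi k) of injective immersions making S an immersed
   submanifold of dimension n of V. Charts may have an empty domain, so finite
   atlases are included. Hausdorffness is automatic, since the topology defined
   by the atlas is finer than the one induced by V. *)
Definition immersed_atlas (V : normedModType R) (n : nat) (S : set V)
    (U : nat -> set 'rV[R]_n) (psi : nat -> 'rV[R]_n -> V) : Prop :=
  [/\ forall k, open (U k) /\ smooth_on (U k) (psi k),
      forall k u v, U k u -> U k v -> psi k u = psi k v -> u = v,
      forall k u, U k u -> injective (fun x => 'D_x (psi k) u),
      S = \bigcup_k (psi k @` U k) &
      forall k l, let D := U k `&` psi k @^-1` (psi l @` U l) in
        open D /\ exists2 tau : 'rV[R]_n -> 'rV[R]_n, smooth_on D tau &
          forall u, D u -> U l (tau u) /\ psi l (tau u) = psi k u].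

(* A 2-form W on an open set of R^n is given by its matrices:
   (W u) j l = W_u (d_j, d_l), so that x |-> x *m W u is the map W^b from row
   vectors (tangent vectors) to row vectors (covectors). *)
Definition closed_form (n : nat) (U : set 'rV[R]_n) (W : 'rV[R]_n -> 'M[R]_n) :=
  let d i j l u := 'D_(delta_mx 0 i) (fun z => W z j l) u in
  forall u, U u -> forall i j l, d i j l u + d j l i u + d l i j u = 0.

Definition symplectic_form (n : nat) (U : set 'rV[R]_n)
    (W : 'rV[R]_n -> 'M[R]_n) : Prop :=
  [/\ smooth_on U W, forall u, U u -> (W u)^T = - W u,
      forall u, U u -> W u \in unitmx & closed_form U W].

(* W i k is the matrix of omega_i in the k-th chart. Maps act on row vectors
   from the right, hence the reversed order of the factors: invmx B *m A is
   A^b o (B^b)^-1. *)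
Definition hypersymplectic (n : nat) (U : nat -> set 'rV[R]_n)
    (W : 'I_3 -> nat -> 'rV[R]_n -> 'M[R]_n) : Prop :=
  (forall i k, symplectic_form (U k) (W i k)) /\
  (forall (i j : 'I_3) k u, i != j -> U k u ->
     let f := invmx (W j k u) *m W i k u in f *m f = - 1%:M).

(* g = omega_3^b o (omega_1^b)^-1 o omega_2^b *)
Definition pseudo_metric (n : nat) (W : 'I_3 -> nat -> 'rV[R]_n -> 'M[R]_n)
    (k : nat) (u : 'rV[R]_n) : 'M[R]_n :=
  W 1 k u *m invmx (W 0 k u) *m W 2 k u.

Definition posdef (n : nat) (g : 'M[R]_n) : Prop :=
  g^T = g /\ forall x : 'rV[R]_n, x != 0 -> 0 < (x *m g *m x^T) 0 0.

Definition hyperkahler (n : nat) (U : nat -> set 'rV[R]_n)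
    (W : 'I_3 -> nat -> 'rV[R]_n -> 'M[R]_n) : Prop :=
  hypersymplectic U W /\
  ((forall k u, U k u -> posdef (pseudo_metric W k u)) \/
   (forall k u, U k u -> posdef (- pseudo_metric W k u))).

End Smooth.

Section Su2.
Context {R : realType}.
Implicit Types x y : 'rV[R]_3.

(* Linear coordinates on su(2), the real Lie algebra of traceless skew-Hermitian
   complex 2 x 2 matrices (see su2P, su2_mx_br); from here on su(2) is
   'rV[R]_3. *)
Definition su2_mx x : 'M[R[i]]_2 :=
  \matrix_(j, k) nth 0 (nth [::]
    [:: [:: Complex 0 (x 0 0);         Complex (x 0 1) (x 0 2)];
        [:: Complex (- x 0 1) (x 0 2); Complex 0 (- x 0 0)]] j) k.

Definition su2_coord (X : 'M[R[i]]_2) : 'rV[R]_3 :=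
  \row_j [:: complex.Im (X 0 0); complex.Re (X 0 1); complex.Im (X 0 1)]`_j.

Definition in_su2 (X : 'M[R[i]]_2) : Prop :=
  map_mx (@conjc R) X^T = - X /\ \tr X = 0.

Definition br x y : 'rV[R]_3 :=
  su2_coord (su2_mx x *m su2_mx y - su2_mx y *m su2_mx x).

Definition killing x y : R := \tr (lin1_mx (br x) *m lin1_mx (br y)).

(* For c > 0 these are the Ad-invariant Euclidean inner products on su(2), the
   Killing form being negative definite. *)
Definition ip (c : R) x y : R := - (c * killing x y).

End Su2.

Section HyperLiePoisson.
Context {R : realType}.
(* lam and mu scale the inner products of g and of the target su(2). A linear
   map phi in M = L(g, su(2)) is the matrix acting on row vectors by
   x |-> x *m phi. *)
Context (lam mu : R).

Notation g := 'rV[R]_3.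
Notation M := 'M[R]_3.
Implicit Types (F : 'I_3 -> 'rV[R]_3) (p : M) (x y xi eta : g).

(* g^* -> g *)
Definition sharp (f : g -> R) : g :=
  (\row_j f (delta_mx 0 j)) *m
  invmx (\matrix_(j, k) ip lam (delta_mx 0 j) (delta_mx 0 k)).

(* s fixes the orientation of the target. *)
Definition frame (s : bool) F : Prop :=
  (forall j k, ip mu (F j) (F k) = (j == k)%:R) /\
  0 < (-1) ^+ s * \det (\matrix_j F j).

(* cyc F 0, cyc F 1, cyc F 2 are F_1, F_2, F_3. *)
Definition cyc F (i : 'I_3) : 'I_3 -> 'rV[R]_3 := fun j => F (j + i).

(* Psi_F p = (Psi F p 0, Psi F p 1, Psi F p 2) = (a, b, c), and PsiV is its
   inverse. *)
Definition Psi F p : 'I_3 -> g := fun j => sharp (fun x => ip mu (F j) (x *m p)).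

Definition PsiV F (a : 'I_3 -> g) : M :=
  lin1_mx (fun x => \sum_j ip lam (a j) x *: F j).

Definition ell F (j : 'I_3) xi p : R := ip lam xi (Psi F p j).

Definition Phi F p : R :=
  let a := Psi F p in ip lam (a 0) (br (a 1) (a 2)).

Definition Mo F : set M := [set p | Phi F p != 0].

Definition A F p xi eta : R :=
  let a := Psi F p in
  let sq v := ip lam v xi * ip lam v eta in
  (Phi F p)^-1 *
  (sq (br (a 0) (a 1)) + sq (br (a 1) (a 2)) + sq (br (a 2) (a 0))).

(* The brackets of ell F j xi and ell F k eta at p. *)
Definition ell_bracket F p (j k : 'I_3) xi eta : R :=
  match val j, val k with
  | 0, 0 => ell F 0 (br xi eta) p
  | 0, 1 | 1, 0 => ell F 1 (br xi eta) p
  | 0, _ | _, 0 => ell F 2 (br xi eta) p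
  | 1, 1 => - ell F 0 (br xi eta) p
  | 1, _ => A F p xi eta
  | _, 1 => - A F p xi eta
  | _, _ => - ell F 0 (br xi eta) p
  end.

(* Covectors on M are matrices of components with respect to the coordinates
   p |-> p k l. *)
Definition pairing (al v : M) : R := \sum_k \sum_l al k l * v k l.

Definition grad (h : M -> R) p : M := \matrix_(k, l) 'D_(delta_mx k l) h p.

(* The covector al is the sum over j of the differentials of
   ell F j (cov_comp F al j). *)
Definition cov_comp F (al : M) (j : 'I_3) : g :=
  sharp (fun x => pairing al (PsiV F (fun k => if k == j then x else 0))).

(* The bivector pi_F at p: the bilinear extension of ell_bracket (see piF_ell). *)
Definition piF F p (al be : M) : R :=
  \sum_j \sum_k ell_bracket F p j k (cov_comp F al j) (cov_comp F be k).

(* pi^# al = pi (al, .), a vector of T_p M = M; delta_mx k l is the covector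
   d p_kl. *)
Definition piF_sharp F p (al : M) : M := \matrix_(k, l) piF F p al (delta_mx k l).

(* q is reached from p along a trajectory of a locally defined Hamiltonian
   vector field of pi_F. *)
Definition ham_arc F p q : Prop :=
  exists (U : set M) (h : M -> R) (gam : R -> M),
    [/\ open U, U `<=` Mo F, smooth_on U h, gam 0 = p /\ gam 1 = q &
        forall t, 0 <= t <= 1 ->
          U (gam t) /\ is_derive t 1 gam (piF_sharp F (gam t) (grad h (gam t)))].

(* A symplectic leaf is an equivalence class of points that can be joined by a
   piecewise Hamiltonian curve. ham_arc is symmetric (replace h by -h), and so
   is its reflexive transitive closure. *)
Definition symplectic_leaf F (S : set M) : Prop :=
  exists2 p, Mo F p & S = [set q | clos_refl_trans M (ham_arc F) p q].

(* The leaves of piF F do not depend on the oriented frame F. *)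
Definition hypersymplectic_leaf (s : bool) (S : set M) : Prop :=
  exists2 F, frame s F & symplectic_leaf F S.

(* The symplectic form at p on the image of pi_F^#, determined by
   omega (pi^# al, pi^# be) = pi (al, be). The right-hand side does not depend
   on the choice of al and be since pi is skew-symmetric. *)
Definition leaf_form F p (v w : M) : R :=
  piF F p (xget 0 [set al | piF_sharp F p al = v])
         (xget 0 [set be | piF_sharp F p be = w]).

(* The pull-back of leaf_form by a parametrization psi of the leaf. *)
Definition leaf_form_mx (n : nat) F (psi : 'rV[R]_n -> M) (u : 'rV[R]_n) :
    'M[R]_n :=
  \matrix_(j, l) leaf_form F (psi u) ('D_(delta_mx 0 j) psi u)
                                     ('D_(delta_mx 0 l) psi u).

(* S is an n-dimensional manifold whose tangent space at p is the image of
   pi_{F_i}^#, and for every oriented frame F the forms omega_i induced by the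
   pi_{F_i} make it hyperkaehler. *)
Definition hyperkahler_leaf (s : bool) (n : nat) (S : set M) : Prop :=
  exists (U : nat -> set 'rV[R]_n) (psi : nat -> 'rV[R]_n -> M),
    immersed_atlas S U psi /\
    forall F, frame s F ->
      (forall i k u, U k u ->
         range (fun v => 'D_v (psi k) u) = range (piF_sharp (cyc F i) (psi k u)))
      /\ hyperkahler U (fun i k => leaf_form_mx (cyc F i) (psi k)).

End HyperLiePoisson.

Section Su2Facts.
Context {R : realType}.
Implicit Types x y : 'rV[R]_3.

Lemma mx2P (T : Type) (X Y : 'M[T]_2) :
  X 0 0 = Y 0 0 -> X 0 1 = Y 0 1 -> X 1 0 = Y 1 0 -> X 1 1 = Y 1 1 -> X = Y.
Proof.
move=> e0 e1 e2 e3; apply/matrixP => j k.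
have E (l : 'I_2) : l = 0 \/ l = 1.
  by case: l => [[|[|//]] lP]; [left|right]; apply/val_inj.
by case: (E j) => ->; case: (E k) => ->.
Qed.

Lemma su2P (X : 'M[R[i]]_2) : in_su2 X <-> exists x, X = su2_mx x.
Proof.
split=> [[XC]|[x ->]].
  rewrite /mxtrace !big_ord_recl big_ord0 addr0 => trX.
  exists (su2_coord X).
  have := congr1 (fun Y : 'M[R[i]]_2 => Y 0 0) XC.
  have := congr1 (fun Y : 'M[R[i]]_2 => Y 1 0) XC.
  have -> : 1 = lift ord0 ord0 :> 'I_2 by apply/val_inj.
  move: trX; rewrite !mxE.
  case E0 : (X 0 0) => [a b]; case E1 : (X 0 (lift _ _)) => [c d].
  case E2 : (X (lift _ _) 0) => [e f]; case E3 : (X (lift _ _) (lift _ _)) => [r t] /=.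
  move=> /eqP; rewrite eq_complex /= => /andP[/eqP ar /eqP bt].
  move=> /eqP; rewrite eq_complex /= => /andP[/eqP ce /eqP df].
  move=> /eqP; rewrite eq_complex /= => /andP[/eqP aa _].
  have l1 : 1 = lift ord0 ord0 :> 'I_2 by apply/val_inj.
  apply: mx2P; rewrite !mxE /= ?l1 ?E0 ?E1 ?E2 ?E3 /=; congr Complex; lra.
split; last first.
  rewrite /mxtrace !big_ord_recl big_ord0 addr0 !mxE /=.
  by apply/eqP; rewrite eq_complex /= !addr0 subrr eqxx.
by apply: mx2P; rewrite !mxE /=; apply/eqP; rewrite eq_complex /= ?oppr0 ?opprK !eqxx.
Qed.

Lemma su2_mxK : cancel (@su2_mx R) (@su2_coord R).
Proof.
move=> x; apply/rowP => j; rewrite !mxE /=.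
case: j => [[|[|[|//]]] jP] /=; congr (x _ _); exact/val_inj.
Qed.

Lemma brE x y : br x y =
  \row_j [:: 2 * (x 0 1 * y 0 2 - x 0 2 * y 0 1);
             2 * (x 0 2 * y 0 0 - x 0 0 * y 0 2);
             2 * (x 0 0 * y 0 1 - x 0 1 * y 0 0)]`_j.
Proof.
apply/rowP => j; rewrite /br /su2_coord !mxE /=.
have l1 : lift ord0 ord0 = 1 :> 'I_2 by apply/val_inj.
rewrite !big_ord_recl !big_ord0 !mxE /=.
case: j => [[|[|[|//]]] jP] /=; ring.
Qed.

Lemma su2_mx_br x y :
  su2_mx (br x y) = su2_mx x *m su2_mx y - su2_mx y *m su2_mx x.
Proof.
rewrite brE; apply: mx2P; rewrite !mxE !big_ord_recl !big_ord0 !mxE /=;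
  apply/eqP; rewrite eq_complex /=; apply/andP; split; apply/eqP; ring.
Qed.

Lemma ord3P (P : 'I_3 -> Prop) : P 0 -> P 1 -> P 2 -> forall j, P j.
Proof.
move=> P0 P1 P2 [[|[|[|//]]] jP].
- by have -> : Ordinal jP = 0 by exact/val_inj.
- by have -> : Ordinal jP = 1 by exact/val_inj.
- by have -> : Ordinal jP = 2 by exact/val_inj.
Qed.

Definition ad_mx x : 'M[R]_3 := \matrix_(j, k) nth 0 (nth [::]
   [:: [:: 0; 2 * x 0 2; - 2 * x 0 1];
       [:: - 2 * x 0 2; 0; 2 * x 0 0];
       [:: 2 * x 0 1; - 2 * x 0 0; 0]] j) k.

Lemma adE x : lin1_mx (br x) = ad_mx x.
Proof.
apply/matrixP => j k.
rewrite mxE brE !mxE; move: (x 0 0) (x 0 1) (x 0 2) => r0 r1 r2.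
by elim/ord3P: j; elim/ord3P: k => /=; ring.
Qed.

Lemma killingE x y : killing x y = - 8 * (x *m y^T) 0 0.
Proof.
have l1 : lift ord0 ord0 = 1 :> 'I_3 by apply/val_inj.
have l2 : lift ord0 (lift ord0 ord0) = 2 :> 'I_3 by apply/val_inj.
have -> : killing x y = \tr (ad_mx x *m ad_mx y).
  exact: (f_equal2 (fun P Q => \tr (P *m Q)) (adE x) (adE y)).
rewrite /mxtrace !big_ord_recl big_ord0 !mxE !big_ord_recl !big_ord0 !mxE l1 l2 /=.
ring.
Qed.

End Su2Facts.

Section PiFacts.
Context {R : realType}.
Context (lam mu : R) (lam0 : 0 < lam).
Implicit Types x y xi eta : 'rV[R]_3.

Lemma ipE (c : R) x y : ip c x y = 8 * c * (x *m y^T) 0 0.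
Proof. rewrite /ip killingE; ring. Qed.

Lemma sharpE (f : 'rV[R]_3 -> R) : sharp lam f = (8 * lam)^-1 *: \row_j f (delta_mx 0 j).
Proof.
have c0 : 8 * lam != 0 by rewrite mulf_neq0 ?pnatr_eq0 ?gt_eqF.
rewrite /sharp.
have -> : (\matrix_(j, k) ip lam (delta_mx 0 j) (delta_mx 0 k) : 'M[R]_3) = (8 * lam)%:M.
  apply/matrixP => j k; rewrite !mxE ipE trmx_delta mul_delta_mx_cond.
  by case: (j == k); rewrite !mxE /= ?mulr1 ?mulr0.
by rewrite invmx_scalar mul_mx_scalar.
Qed.

Lemma ip_sharp (f : {linear 'rV[R]_3 -> R^o}) x : ip lam (sharp lam f) x = f x.
Proof.
have c0 : 8 * lam != 0 by rewrite mulf_neq0 ?pnatr_eq0 ?gt_eqF.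
rewrite sharpE ipE -scalemxAl mxE mulVKf // mxE [in RHS](row_sum_delta x) linear_sum.
by apply: eq_bigr => j _; rewrite linearZ /= !mxE mulrC.
Qed.

Lemma sharp_ip xi : sharp lam (ip lam xi) = xi.
Proof.
have c0 : 8 * lam != 0 by rewrite mulf_neq0 ?pnatr_eq0 ?gt_eqF.
apply/rowP => j; rewrite sharpE !mxE ipE mulKf // mxE (bigD1 j) //= big1 ?addr0.
  by rewrite !mxE !eqxx mulr1.
by move=> k kj; rewrite !mxE (negbTE kj) andbF mulr0.
Qed.

Lemma derive_lin (V : normedModType R) (f : {linear V -> R^o}) (v p : V) :
  'D_v f p = f v.
Proof.
apply: cvg_lim => //; apply: cvg_near_cst.
near=> h; rewrite /= [f (_ + _)]linearD addrK linearZ /= scalerA mulVf ?scale1r //.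
by near: h; exact: nbhs_dnbhs_neq.
Unshelve. all: by end_near. Qed.

Context (F : 'I_3 -> 'rV[R]_3)
  (F_on : forall j k, ip mu (F j) (F k) = (j == k)%:R).

Lemma ipC (c : R) x y : ip c x y = ip c y x.
Proof. by rewrite !ipE -[x *m y^T]trmxK trmx_mul trmxK mxE. Qed.

Lemma ip_lin (c : R) x : linear (ip c x : _ -> R^o).
Proof.
move=> k y z; rewrite !ipE linearP /= mulmxDr -scalemxAr mxE [in LHS]mxE mulrDr.
by congr (_ + _); rewrite mulrCA.
Qed.

Lemma ipZl (c : R) x k y : ip c x (k *: y) = k * ip c x y.
Proof. by rewrite !ipE linearZ /= -scalemxAr mxE mulrCA. Qed.

Lemma ip0r (c : R) x : ip c x 0 = 0.
Proof. by rewrite ipE trmx0 mulmx0 mxE mulr0. Qed.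

Lemma ip0l (c : R) x : ip c 0 x = 0.
Proof. by rewrite ipC ip0r. Qed.

Lemma ip_sum (c : R) x (I : finType) (h : I -> 'rV[R]_3) :
  ip c x (\sum_i h i) = \sum_i ip c x (h i).
Proof. by rewrite ipE linear_sum mulmx_sumr summxE mulr_sumr; apply: eq_bigr => i _; rewrite ipE. Qed.

Lemma ellE j xi p : ell lam mu F j xi p = ip mu (F j) (xi *m p).
Proof.
have fl : linear (fun x : 'rV[R]_3 => ip mu (F j) (x *m p) : R^o).
  by move=> k x y; rewrite mulmxDl -scalemxAl ip_lin.
pose fL := GRing.isLinear.Build R 'rV[R]_3 R^o *:%R _ fl.
pose f : {linear 'rV[R]_3 -> R^o} := HB.pack (fun x : 'rV[R]_3 => ip mu (F j) (x *m p) : R^o) fL.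
by rewrite /ell ipC /Psi -[RHS](ip_sharp f).
Qed.

Lemma pairing_grad_ell j xi p (v : 'M[R]_3) :
  pairing (grad (ell lam mu F j xi) p) v = ell lam mu F j xi v.
Proof.
have fl : linear (ell lam mu F j xi : _ -> R^o).
  by move=> k x y; rewrite !ellE mulmxDr -scalemxAr ip_lin.
pose fL := GRing.isLinear.Build R 'M[R]_3 R^o *:%R _ fl.
pose f : {linear 'M[R]_3 -> R^o} := HB.pack (ell lam mu F j xi : _ -> R^o) fL.
rewrite /pairing -[RHS]/(f v) [in RHS](matrix_sum_delta v) linear_sum.
apply: eq_bigr => k _; rewrite linear_sum; apply: eq_bigr => l _.
by rewrite linearZ /= mxE mulrC (derive_lin f).
Qed.

Lemma ell_PsiV j xi a : ell lam mu F j xi (PsiV lam F a) = ip lam xi (a j).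
Proof.
have fl : linear (fun x => \sum_j ip lam (a j) x *: F j).
  move=> k x y; rewrite scaler_sumr -big_split; apply: eq_bigr => i _.
  by rewrite ip_lin scalerDl scalerA.
pose fL := GRing.isLinear.Build R 'rV[R]_3 'rV[R]_3 *:%R _ fl.
pose f : {linear 'rV[R]_3 -> 'rV[R]_3} := HB.pack (fun x => \sum_j ip lam (a j) x *: F j) fL.
rewrite ellE /PsiV -[X in X *m lin1_mx _]/xi (mul_rV_lin1 f) /= ip_sum.
rewrite (bigD1 j) //= big1 ?addr0 => [|i ij].
  by rewrite ipZl F_on eqxx mulr1 ipC.
by rewrite ipZl F_on eq_sym (negbTE ij) mulr0.
Qed.

Lemma cov_comp_ell j k xi p :
  cov_comp lam F (grad (ell lam mu F j xi) p) k = if k == j then xi else 0.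
Proof.
rewrite /cov_comp -[RHS]sharp_ip; congr sharp; apply/funext => x.
by rewrite pairing_grad_ell ell_PsiV eq_sym; case: eqP; rewrite ?ip0r ?ip0l.
Qed.

Lemma br0r x : br x 0 = 0.
Proof. by rewrite brE; apply/rowP; elim/ord3P; rewrite !mxE /=; ring. Qed.

Lemma br0l x : br 0 x = 0.
Proof. by rewrite brE; apply/rowP; elim/ord3P; rewrite !mxE /=; ring. Qed.

Lemma ell0 j p : ell lam mu F j 0 p = 0.
Proof. exact: ip0l. Qed.

Lemma A0 p xi eta : xi = 0 \/ eta = 0 -> A lam mu F p xi eta = 0.
Proof.
move=> e; have sq0 v : ip lam v xi * ip lam v eta = 0.
  by case: e => ->; rewrite ip0r ?mul0r ?mulr0.
transitivity ((Phi lam mu F p)^-1 * (0 + 0 + 0)); last by rewrite !addr0 mulr0.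
by congr (_ * (_ + _ + _)); exact: sq0.
Qed.

Lemma ell_bracket0 p j k xi eta : xi = 0 \/ eta = 0 ->
  ell_bracket lam mu F p j k xi eta = 0.
Proof.
move=> e; have br0 : br xi eta = 0 by case: e => ->; rewrite ?br0l ?br0r.
rewrite /ell_bracket br0 !ell0 A0 // oppr0.
by case: (val j) => [|[|]]; case: (val k) => [|[|]].
Qed.

Lemma piF_ell p j k xi eta :
  piF lam mu F p (grad (ell lam mu F j xi) p) (grad (ell lam mu F k eta) p) =
  ell_bracket lam mu F p j k xi eta.
Proof.
transitivity (\sum_j' \sum_k' ell_bracket lam mu F p j' k'
    (if j' == j then xi else 0) (if k' == k then eta else 0)).
  apply: eq_bigr => j' _; apply: eq_bigr => k' _.
  exact: (f_equal2 (ell_bracket lam mu F p j' k')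
            (cov_comp_ell j j' xi p) (cov_comp_ell k k' eta p)).
rewrite (bigD1 j) //= [X in _ + X]big1 ?addr0 => [|j' jj]; last first.
  by apply: big1 => k' _; apply: ell_bracket0; rewrite (negbTE jj); left.
rewrite (bigD1 k) //= big1 ?addr0 ?eqxx // => k' kk.
by apply: ell_bracket0; rewrite (negbTE kk); right.
Qed.

End PiFacts.

(* Main.v *)
Require Import Defs.
From HB Require Import structures.
From mathcomp Require Import all_boot all_order all_algebra.
From mathcomp Require Import ring lra.
From mathcomp Require Import all_classical all_reals all_analysis.
Set Implicit Arguments.
Unset Strict Implicit.
Unset Printing Implicit Defensive.
Import Order.TTheory GRing.Theory Num.Theory.
Import numFieldNormedType.Exports.
Local Open Scope classical_set_scope.
Local Open Scope ring_scope.

(* A point p of M is an invertible matrix, and a vector v is tangent to the leaf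
   through p iff p^T v is the sum of a scalar matrix t and a skew matrix hat z.
   Hence p^T p modulo scalar matrices and the sign of det p are constant on the
   leaves. Conversely all points with the same invariants are joined by
   Hamiltonian curves, so that the leaf is SO(3) times an interval: its points
   are R C(t), where R is a rotation and C(t)^T C(t) = p^T p + t is a Cholesky
   factorisation. Cayley coordinates on four translates of SO(3) give the atlas.

   In the coordinates (z, t) of tangent vectors, omega_i is 4 mu / det p times
   the constant form < F_i, z x z' + t' z - t z' >. The three constant forms are
   (multiples of) the left multiplications by i, j, k in the quaternions, which
   gives the hypersymplectic relations and shows that g is a multiple of the
   Euclidean inner product, of constant sign. Finally omega_i is exact in the
   charts: up to a factor it is the differential of < F_i, w C(t) >, where w is
   the left-invariant Maurer-Cartan form of SO(3). *)

(** * Vectors and matrices in dimension three *)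

(** The special form of [A] is what makes the left trivialisation work. The cross products of the
    vectors [F j *m p^T] are made of cofactors of [p], so for invertible [p] the tensor [A] is, up
    to a constant, [\det p] times the inverse of [p *m p^T]. When covectors are written as [p *m Y],
    the cofactor identity [mul_cross] therefore extracts [p] from every bracket, those given by [A]
    included, at the cost of one factor [\det p]. What remains sees [Y] only through its trace and
    its skew part: four numbers, whence the dimension 4.

    The parametrisations are kept algebraic, with Cayley's map in place of the exponential and
    Cholesky's factor in place of the symmetric square root, so that all identities reduce to [ring]
    and [field]. The delicate point of connectedness is that a Hamiltonian arc must be a trajectory
    of a time-independent function on an open subset of [M]; time must be recovered from the
    position by a smooth function. *)

Section LinearAlgebra3.
Context {R : realType}.
Implicit Types (x y z f g h : 'rV[R]_3) (A B N Y : 'M[R]_3).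

Lemma sum3 (V : nmodType) (t : 'I_3 -> V) : \sum_i t i = t 0 + t 1 + t 2.
Proof.
rewrite !big_ord_recl big_ord0 addr0 addrA.
by congr (_ + t _ + t _); exact/val_inj.
Qed.

Lemma det2 (B : 'M[R]_2) : \det B = B 0 0 * B 1 1 - B 0 1 * B 1 0.
Proof.
have l0 : lift 0 0 = 1 :> 'I_2 by exact/val_inj.
have l1 : lift 1 0 = 0 :> 'I_2 by exact/val_inj.
rewrite (expand_det_row B 0) !big_ord_recl big_ord0 /cofactor !det_mx11 !mxE.
by rewrite /= !l0 !l1 /= !expr0 !expr1; ring.
Qed.

Lemma det3 A : \det A =
  A 0 0 * (A 1 1 * A 2 2 - A 1 2 * A 2 1) -
  A 0 1 * (A 1 0 * A 2 2 - A 1 2 * A 2 0) +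
  A 0 2 * (A 1 0 * A 2 1 - A 1 1 * A 2 0).
Proof.
have l00 : lift 0 0 = 1 :> 'I_3 by exact/val_inj.
have l01 : lift 0 1 = 2 :> 'I_3 by exact/val_inj.
have l10 : lift 1 0 = 0 :> 'I_3 by exact/val_inj.
have l11 : lift 1 1 = 2 :> 'I_3 by exact/val_inj.
have l20 : lift 2 0 = 0 :> 'I_3 by exact/val_inj.
have l21 : lift 2 1 = 1 :> 'I_3 by exact/val_inj.
rewrite (expand_det_row A 0) sum3 /cofactor !det2 !mxE.
rewrite ?l00 ?l01 ?l10 ?l11 ?l20 ?l21 /=.
ring.
Qed.

Definition dot x y : R := x 0 0 * y 0 0 + x 0 1 * y 0 1 + x 0 2 * y 0 2.

Lemma dotE x y : (x *m y^T) 0 0 = dot x y.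
Proof. by rewrite mxE sum3 !mxE. Qed.

Definition cross x y : 'rV[R]_3 :=
  \row_j [:: x 0 1 * y 0 2 - x 0 2 * y 0 1;
             x 0 2 * y 0 0 - x 0 0 * y 0 2;
             x 0 0 * y 0 1 - x 0 1 * y 0 0]`_j.

Definition hat z : 'M[R]_3 := \matrix_(j, k) nth 0 (nth [::]
  [:: [:: 0; - z 0 2; z 0 1]; [:: z 0 2; 0; - z 0 0]; [:: - z 0 1; z 0 0; 0]] j) k.

Definition axial Y : 'rV[R]_3 :=
  \row_j [:: Y 2 1 - Y 1 2; Y 0 2 - Y 2 0; Y 1 0 - Y 0 1]`_j.

Lemma matrix3P (T : Type) (A B : 'M[T]_3) :
  [/\ A 0 0 = B 0 0, A 0 1 = B 0 1 & A 0 2 = B 0 2] ->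
  [/\ A 1 0 = B 1 0, A 1 1 = B 1 1 & A 1 2 = B 1 2] ->
  [/\ A 2 0 = B 2 0, A 2 1 = B 2 1 & A 2 2 = B 2 2] -> A = B.
Proof.
move=> [? ? ?] [? ? ?] [? ? ?].
by apply/matrixP; elim/ord3P; elim/ord3P.
Qed.

Lemma row3P (T : Type) (x y : 'rV[T]_3) :
  x 0 0 = y 0 0 -> x 0 1 = y 0 1 -> x 0 2 = y 0 2 -> x = y.
Proof. by move=> ? ? ?; apply/rowP; elim/ord3P. Qed.

End LinearAlgebra3.

Ltac entries := rewrite /dot /axial /cross /hat ?det3 ?(mxE, sum3, dotE) /=.
Ltac mx3 := first [apply: matrix3P; split | apply: row3P | idtac]; entries.

Section LinearAlgebra3Theory.
Context {R : realType}.
Implicit Types (x y z f g h : 'rV[R]_3) (A B N Y : 'M[R]_3).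

(** Paired with a third vector [z], both sides become [\det A] times the triple product of [x], [y],
    [z]. *)
Lemma mul_cross A x y : cross (x *m A^T) (y *m A^T) *m A = \det A *: cross x y.
Proof. mx3; ring. Qed.

Lemma row_mul_hatT x z : x *m (hat z)^T = cross z x.
Proof. mx3; ring. Qed.

Lemma row_mul_hat x z : x *m hat z = cross x z.
Proof. mx3; ring. Qed.

Lemma hatZ (k : R) z : hat (k *: z) = k *: hat z.
Proof. mx3; ring. Qed.

Lemma hatD x y : hat (x + y) = hat x + hat y.
Proof. mx3; ring. Qed.

(** Linearising [mul_cross] at the identity turns the left-hand side into [cross f g *m (Y - Y^T) -
    \tr Y *: cross f g]. As [Y - Y^T = hat (axial Y)], the first term is a double cross product,
    which is then expanded. *)
Lemma sharp_identity f g Y :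
  cross g (f *m Y^T) - cross f (g *m Y^T) - cross f g *m Y^T =
  dot f (axial Y) *: g - dot (axial Y) g *: f - \tr Y *: cross f g.
Proof. rewrite /mxtrace; mx3; ring. Qed.

End LinearAlgebra3Theory.

(** * The Poisson structures in a frame *)

Section Dot.
Context {R : realType}.
Implicit Types (x y z f g h : 'rV[R]_3) (A B N Y : 'M[R]_3).

Lemma sum33 (V : nmodType) (t : 'I_3 -> 'I_3 -> V) : \sum_j \sum_k t j k =
  t 0 0 + t 0 1 + t 0 2 + (t 1 0 + t 1 1 + t 1 2) + (t 2 0 + t 2 1 + t 2 2).
Proof. by rewrite !sum3. Qed.

Lemma dotC x y : dot x y = dot y x.
Proof. rewrite /dot; ring. Qed.

Lemma dotZl (k : R) x y : dot (k *: x) y = k * dot x y.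
Proof. rewrite /dot !mxE; ring. Qed.

Lemma dotZr (k : R) x y : dot x (k *: y) = k * dot x y.
Proof. by rewrite dotC dotZl dotC. Qed.

Lemma dot_mull A x y : dot (x *m A) y = dot x (y *m A^T).
Proof. by rewrite -!dotE trmx_mul trmxK mulmxA. Qed.

Lemma dotDl x y z : dot (x + y) z = dot x z + dot y z.
Proof. rewrite /dot !mxE; ring. Qed.

Lemma dotNl x y : dot (- x) y = - dot x y.
Proof. rewrite /dot !mxE; ring. Qed.

Lemma dot_cross x y z : dot x (cross y z) = dot (cross x y) z.
Proof. rewrite /dot !mxE /=; ring. Qed.

Lemma ip_dot (c : R) x y : ip c x y = 8 * c * dot x y.
Proof. by rewrite ipE dotE. Qed.

Lemma br_cross x y : br x y = 2 *: cross x y.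
Proof. rewrite brE; mx3; ring. Qed.

Lemma crossZl (k : R) x y : cross (k *: x) y = k *: cross x y.
Proof. mx3; ring. Qed.

Lemma crossZr (k : R) x y : cross x (k *: y) = k *: cross x y.
Proof. mx3; ring. Qed.

Lemma crossC x y : cross x y = - cross y x.
Proof. mx3; ring. Qed.

Lemma pairing_trace A B : pairing A B = \tr (A^T *m B).
Proof.
rewrite /pairing /mxtrace exchange_big; apply: eq_bigr => l _.
by rewrite mxE; apply: eq_bigr => k _; rewrite mxE.
Qed.

Lemma mxtrace_mul_hat Y z : \tr (Y^T *m hat z) = dot z (axial Y).
Proof. rewrite /mxtrace sum3 /dot /hat /axial !(mxE, sum3) /=; ring. Qed.

End Dot.

Section Frame.
Context {R : realType} (lam mu : R) (lam0 : 0 < lam) (mu0 : 0 < mu) (s : bool).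
Context (F : 'I_3 -> 'rV[R]_3) (FP : frame mu s F).
Implicit Types (x y : 'rV[R]_3) (p al be Y : 'M[R]_3).

Let r := (8 * mu)^-1.
Let Fm := \matrix_j F j.
Let phi := \det Fm.

Lemma normsq_gt0 : 0 < r.
Proof. by rewrite invr_gt0 mulr_gt0. Qed.
Let r_neq0 : r != 0. Proof. by rewrite gt_eqF // normsq_gt0. Qed.

Lemma dot_frame j k : dot (F j) (F k) = r * (j == k)%:R.
Proof.
by rewrite -(FP.1 j k) ip_dot mulrA mulVf ?mul1r // -[8 * mu]invrK invr_neq0.
Qed.

Lemma frame_mulT : Fm *m Fm^T = r%:M.
Proof.
apply/matrixP => j k; rewrite mxE sum3 !mxE.
by have := dot_frame j k; rewrite /dot mulr_natr.
Qed.

Lemma frame_Tmul : Fm^T *m Fm = r%:M.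
Proof.
have /mulmx1C : Fm *m (r^-1 *: Fm^T) = 1%:M.
  by rewrite -scalemxAr frame_mulT scale_scalar_mx mulVf.
by rewrite -scalemxAl => /(congr1 ( *:%R r));
  rewrite scalerA mulfV // scale1r scale_scalar_mx mulr1.
Qed.

Lemma frame_decomp x : r *: x = \sum_j dot x (F j) *: F j.
Proof.
rewrite -mul_mx_scalar -frame_Tmul mulmxA mulmx_sum_row; apply: eq_bigr => j _.
by rewrite rowK; congr (_ *: _); rewrite mxE sum3 !mxE.
Qed.

Lemma frame_det_neq0 : phi != 0.
Proof.
by apply: contraTN FP.2 => /eqP; rewrite /phi => ->; rewrite mulr0 ltxx.
Qed.

Lemma frame_eq x y : (forall j, dot x (F j) = dot y (F j)) -> x = y.
Proof.
move=> e; apply: (scalerI r_neq0); rewrite !frame_decomp.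
by apply: eq_bigr => j _; rewrite e.
Qed.

(** Since [phi ^+ 2 = r ^+ 3], the factor [phi / r] is the common length of the frame vectors with
    the sign of the orientation, written without a square root. *)
Lemma cross_frame : [/\ cross (F 0) (F 1) = (phi / r) *: F 2,
  cross (F 1) (F 2) = (phi / r) *: F 0 & cross (F 2) (F 0) = (phi / r) *: F 1].
Proof.
by split; apply: frame_eq; elim/ord3P; rewrite dotZl dot_frame ?mulr1 ?mulr0 ?divfK //;
  rewrite /phi ?det3 /Fm /dot /cross !mxE /=; ring.
Qed.

(** The factor [8 * lam] of the inner product in [PsiV] is undone by [sharp]. *)
Lemma cov_compE al j : cov_comp lam F al j = F j *m al^T.
Proof.
have c0 : 8 * lam != 0 by rewrite mulf_neq0 ?pnatr_eq0 ?gt_eqF.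
rewrite /cov_comp sharpE //; apply/rowP => i; rewrite !mxE /pairing.
apply: (mulfI c0); rewrite mulVKf // mulr_sumr (bigD1 i) //= [X in _ + X]big1 ?addr0.
  apply: eq_bigr => l _; rewrite !mxE summxE (bigD1 j) //= big1 => [|k /negbTE ->].
    by rewrite eqxx addr0 mxE ip_dot -dotE trmx_delta mul_delta_mx mxE eqxx /= mulr1; ring.
  by rewrite mxE ip0l mul0r.
move=> k /negbTE ki; apply: big1 => l _; rewrite !mxE summxE big1 ?mulr0 // => k' _.
rewrite mxE; case: eqP => _; last by rewrite ip0l mul0r.
by rewrite ip_dot -dotE trmx_delta mul_delta_mx_cond eq_sym ki mxE mulr0 mul0r.
Qed.

Let a p j := F j *m p^T.

Lemma PsiE p j : Psi lam mu F p j = (mu / lam) *: a p j.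
Proof.
have l0 : lam != 0 by rewrite gt_eqF.
rewrite /Psi sharpE //; apply/rowP => i; rewrite !mxE ip_dot.
rewrite -dotE trmx_mul mulmxA trmx_delta.
have -> : ((F j *m p^T) *m (delta_mx i 0 : 'cV_3)) 0 0 = (F j *m p^T) 0 i :> R.
  by rewrite -colE mxE.
by rewrite mxE; field.
Qed.

Lemma PhiE p : Phi lam mu F p = 16 * lam * (mu / lam) ^+ 3 * (phi * \det p).
Proof.
have -> : phi * \det p = \det (Fm *m p^T) by rewrite det_mulmx det_tr.
rewrite /Phi !PsiE br_cross ip_dot !crossZl !crossZr !dotZl !dotZr /a det3 /dot /cross.
by rewrite !(mxE, sum3) /=; ring.
Qed.

Lemma MoE : Mo lam mu F = [set p | \det p != 0].
Proof.
apply/seteqP; split => p; rewrite /Mo /= PhiE;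
  first by rewrite !mulf_eq0 !negb_or => /andP[_ /andP[]].
move=> p0; apply: mulf_neq0; last by apply: mulf_neq0 => //; exact: frame_det_neq0.
by rewrite gt_eqF // mulr_gt0 ?exprn_gt0 ?divr_gt0 ?mulr_gt0.
Qed.

(** Up to a constant, the endomorphism of [g] that corresponds to the symmetric tensor [A]. *)
Definition twist p y : 'rV[R]_3 := (phi * \det p)^-1 *:
  \sum_j dot (cross (a p j) (a p (j + 1))) y *: cross (a p j) (a p (j + 1)).

Lemma A_twist p x y : A lam mu F p x y = 16 * mu * dot (twist p x) y.
Proof.
have l0 : lam != 0 by rewrite gt_eqF.
(* In the degenerate case both sides vanish through the convention [0^-1 = 0]. *)
have [p0|p0] := eqVneq (phi * \det p) 0.
  by rewrite /A PhiE /twist p0 mulr0 invr0 scale0r mul0r -dotE mul0mx mxE mulr0.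
have m0 : mu != 0 by rewrite gt_eqF.
rewrite /A PhiE !PsiE !br_cross !crossZl !crossZr !ip_dot !dotZl /twist sum3.
have -> : 1 + 1 = 2 :> 'I_3 by exact/val_inj.
have -> : 2 + 1 = 0 :> 'I_3 by exact/val_inj.
rewrite add0r.
set c0 := cross (a p 0) _; set c1 := cross (a p 1) _; set c2 := cross (a p 2) _.
have -> : dot (dot c0 x *: c0 + dot c1 x *: c1 + dot c2 x *: c2) y =
  dot c0 x * dot c0 y + dot c1 x * dot c1 y + dot c2 x * dot c2 y.
  by rewrite !dotDl !dotZl.
move: (phi * \det p) (dot c0 x) (dot c1 x) (dot c2 x) (dot c0 y) (dot c1 y) (dot c2 y) p0.
by move=> D d0 d1 d2 e0 e1 e2 D0; field; rewrite D0 l0 m0.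
Qed.

(** Entry [j] collects the brackets with second index [j], solved for their last argument by means
    of [dot_cross]; the opposite signs of [twist] come from the two brackets that are given by
    [A]. *)
Definition sharp_row p al : 'I_3 -> 'rV[R]_3 := fun j =>
  let al' j := F j *m al^T in
  [:: cross (a p 0) (al' 0) + cross (a p 1) (al' 1) + cross (a p 2) (al' 2);
      cross (a p 1) (al' 0) - cross (a p 0) (al' 1) - twist p (al' 2);
      cross (a p 2) (al' 0) - cross (a p 0) (al' 2) + twist p (al' 1)]`_j.

Lemma ell_br j x y p :
  ell lam mu F j (br x y) p = 16 * mu * dot (a p j) (cross x y).
Proof. by rewrite ellE // ip_dot br_cross -scalemxAl dotZr dotC dot_mull dotC /a; ring. Qed.

Let bil p (j k : 'I_3) x y : R :=
  match val j, val k with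
  | 0, 0 => dot (a p 0) (cross x y)
  | 0, 1 | 1, 0 => dot (a p 1) (cross x y)
  | 0, _ | _, 0 => dot (a p 2) (cross x y)
  | 1, 1 => - dot (a p 0) (cross x y)
  | 1, _ => dot (twist p x) y
  | _, 1 => - dot (twist p x) y
  | _, _ => - dot (a p 0) (cross x y)
  end.

Lemma ell_bracketE p j k x y :
  ell_bracket lam mu F p j k x y = 16 * mu * bil p j k x y.
Proof.
rewrite /ell_bracket /bil.
by case: (val j) => [|[|?]]; case: (val k) => [|[|?]];
  rewrite ?A_twist ?ell_br ?mulrN.
Qed.

Lemma piF_sharp_row p al be : piF lam mu F p al be =
  16 * mu * \sum_j dot (sharp_row p al j) (F j *m be^T).
Proof.
transitivity (16 * mu * \sum_j \sum_k bil p j k (F j *m al^T) (F k *m be^T)).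
  rewrite /piF mulr_sumr; apply: eq_bigr => j _.
  rewrite mulr_sumr; apply: eq_bigr => k _.
  by rewrite ell_bracketE !cov_compE.
congr (_ * _); rewrite sum33 sum3 /bil /sharp_row /=.
move: (F 0 *m al^T) (F 1 *m al^T) (F 2 *m al^T) => al0 al1 al2.
rewrite !dot_cross !dotDl !dotNl; ring.
Qed.

Lemma piF_frame p al be : piF lam mu F p al be =
  pairing be ((16 * mu) *: ((\matrix_j sharp_row p al j)^T *m Fm)).
Proof.
rewrite piF_sharp_row pairing_trace -scalemxAr mxtraceZ mulmxA mxtrace_mulC mulmxA.
congr (_ * _); apply: eq_bigr => j _; rewrite dotC -dotE !mxE.
by apply: eq_bigr => k _; rewrite !mxE; congr (_ * _); apply: eq_bigr => l _; rewrite !mxE.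
Qed.

Lemma piF_sharpE p al : piF_sharp lam mu F p al =
  (16 * mu) *: ((\matrix_j sharp_row p al j)^T *m Fm).
Proof.
apply/matrixP => k l; rewrite [LHS]mxE piF_frame /pairing.
rewrite (bigD1 k) //= [X in _ + X]big1 ?addr0 => [|k' /negbTE kk]; last first.
  by apply: big1 => l' _; rewrite mxE kk mul0r.
rewrite (bigD1 l) //= big1 ?addr0 => [|l' /negbTE ll].
  by rewrite [delta_mx _ _ _ _]mxE !eqxx mul1r.
by rewrite [delta_mx _ _ _ _]mxE ll andbF mul0r.
Qed.

Lemma piF_pairing p al be :
  piF lam mu F p al be = pairing be (piF_sharp lam mu F p al).
Proof.
by rewrite piF_sharpE piF_frame.
Qed.

End Frame.

(** * The Poisson tensor, its inverse and the leaf forms in the left trivialisation *)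

Section Sharp.
Context {R : realType} (lam mu : R) (lam0 : 0 < lam) (mu0 : 0 < mu) (s : bool).
Context (F : 'I_3 -> 'rV[R]_3) (FP : frame mu s F).
Implicit Types (x y z : 'rV[R]_3) (p al be Y v w N : 'M[R]_3).

Let r := (8 * mu)^-1.
Let Fm := \matrix_j F j.
Let phi := \det Fm.
Let r_neq0 : r != 0. Proof. by rewrite gt_eqF // normsq_gt0. Qed.

(** In other words, [twist] is a multiple of the inverse of [p *m p^T]: multiplication by [p] brings
    each cross product back to the frame by [mul_cross], and [frame_decomp] reassembles [y]. *)
Lemma twist_mul p y : \det p != 0 ->
  twist F p (y *m p^T) *m p = (\det p * (phi / r)) *: y.
Proof.
move=> p0; have phi0 := frame_det_neq0 FP; rewrite -/Fm -/phi in phi0.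
have cE j : dot (cross (F j *m p^T) (F (j + 1) *m p^T)) (y *m p^T) =
    \det p * dot (cross (F j) (F (j + 1))) y.
  by rewrite dotC dot_mull trmxK mul_cross dotZr dotC.
rewrite /twist -scalemxAl mulmx_suml.
under eq_bigr do rewrite cE -scalemxAl mul_cross.
have [c0 c1 c2] := cross_frame mu0 FP.
rewrite sum3.
have -> : 0 + 1 = 1 :> 'I_3 by exact/val_inj.
have -> : 1 + 1 = 2 :> 'I_3 by exact/val_inj.
have -> : 2 + 1 = 0 :> 'I_3 by exact/val_inj.
rewrite c0 c1 c2 -/Fm -/phi -/r !dotZl.
have := frame_decomp mu0 FP y; rewrite sum3 -/r !(dotC y) => e.
have -> : y = r^-1 *: (r *: y) by rewrite scalerA mulVf // scale1r.
rewrite {4}e !dotZr; move: (F 0) (F 1) (F 2) => f0 f1 f2.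
have rn := r_neq0; move: (dot f0 y) (dot f1 y) (dot f2 y) => d0 d1 d2.
by apply/rowP => i; rewrite !mxE -/phi; field; rewrite rn phi0 p0.
Qed.

Lemma sum_cross_axial (A Y : 'M[R]_3) :
  \sum_j cross (row j A) (row j A *m Y^T) = axial (Y *m (A^T *m A)).
Proof. rewrite sum3; mx3; ring. Qed.

(** For [j] equal to 1 or 2, [mul_cross] and [twist_mul] pull out [\det p], and [cross_frame] makes
    the contribution of [A] the third term of [sharp_identity]. Only [\tr Y] and [axial Y] survive,
    so the bivector has rank at most 4. *)
Lemma sharp_row_mul p Y j : \det p != 0 -> sharp_row F p (p *m Y) j *m p =
  \det p *: (dot (F 0) (axial Y) *: F j +
             cross (cross (F 0) (axial Y) - \tr Y *: F 0) (F j)).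
Proof.
move=> p0; rewrite /sharp_row trmx_mul !mulmxA.
have [c0 _ c2] := cross_frame mu0 FP.
have E2 g : cross g (F 0 *m Y^T) - cross (F 0) (g *m Y^T) - cross (F 0) g *m Y^T =
    dot (F 0) (axial Y) *: g - dot (axial Y) g *: F 0 - \tr Y *: cross (F 0) g.
  exact: sharp_identity.
(* Orthogonality allows the term [dot (F 0) g *: axial Y] to be added, which completes a double
   cross product. *)
have E3 g : dot (F 0) g = 0 -> dot (F 0) (axial Y) *: g - dot (axial Y) g *: F 0 -
     \tr Y *: cross (F 0) g = dot (F 0) (axial Y) *: g +
     cross (cross (F 0) (axial Y) - \tr Y *: F 0) g.
  move=> g0; transitivity (dot (F 0) (axial Y) *: g + dot (F 0) g *: axial Y - dot
    (axial Y) g *: F 0 -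
     \tr Y *: cross (F 0) g); first by rewrite g0 scale0r addr0.
  by move: (axial Y) (\tr Y) => a t; mx3; ring.
elim/ord3P: j => /=.
- rewrite !mulmxDl !mul_cross -!scalerDr; congr (_ *: _).
  have := sum_cross_axial Fm Y; rewrite sum3 !rowK (frame_Tmul mu0 FP) => ->.
  have := dot_frame mu0 FP 0 0; rewrite eqxx mulr1 => d00.
  (* The right-hand side is the decomposition of this vector along and across [F 0]. *)
  transitivity (dot (F 0) (F 0) *: axial Y); first by rewrite d00; mx3; ring.
  by move: (axial Y) (\tr Y) => a t; mx3; ring.
- rewrite !mulmxBl !mul_cross twist_mul // -scalerA -!scalerBr; congr (_ *: _).
  by rewrite -E3 ?(dot_frame mu0 FP) ?mulr0 // -E2 c0 scalemxAl.
- rewrite mulmxDl mulmxBl !mul_cross twist_mul // -scalerA -scalerBr -scalerDr.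
  congr (_ *: _); rewrite -E3 ?(dot_frame mu0 FP) ?mulr0 // -E2 [cross (F 0) (F
    2)]crossC c2.
  by rewrite mulNmx opprK scalemxAl.
Qed.

(* In the left-trivialisation [v |-> p^T v] the Poisson tensor is constant up
   to the factor [\det p]. *)
Lemma mul_piF_sharp p Y : \det p != 0 ->
  p^T *m piF_sharp lam mu F p (p *m Y) = (2 * \det p) *:
    ((dot (F 0) (axial Y))%:M + hat (cross (F 0) (axial Y) - \tr Y *: F 0)).
Proof.
move=> p0; set N := _ + hat _; set al := p *m Y.
have BE : (\matrix_j sharp_row F p al j) *m p = \det p *: (Fm *m N^T).
  apply/row_matrixP => j; rewrite row_mul rowK sharp_row_mul //.
  have -> : row j (\det p *: (Fm *m N^T)) = \det p *: (F j *m N^T).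
    by apply/rowP => i; rewrite !mxE; congr (_ * _); apply: eq_bigr => k _; rewrite !mxE.
  have -> : N^T = (dot (F 0) (axial Y))%:M + (hat (cross (F 0) (axial Y) - \tr Y *: F 0))^T.
    by rewrite -[X in X + _]tr_scalar_mx; apply/matrixP => i k;
      rewrite mxE [LHS]mxE [RHS]mxE; congr (_ + _); rewrite [RHS]mxE.
  by rewrite mulmxDr mul_mx_scalar row_mul_hatT.
rewrite (piF_sharpE lam0 mu0) -scalemxAr mulmxA -trmx_mul BE linearZ /= trmx_mul trmxK.
rewrite -scalemxAl -mulmxA (frame_Tmul mu0 FP) mul_mx_scalar !scalerA -/r.
by congr (_ *: _); rewrite /r; field; rewrite gt_eqF.
Qed.

Definition tangent p v := exists t : R, exists z, p^T *m v = t%:M + hat z.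

Lemma tangent_piF_sharp p al : \det p != 0 -> tangent p (piF_sharp lam mu F p al).
Proof.
move=> p0; have pu : p \in unitmx by rewrite unitmxE unitfE.
have -> : al = p *m (invmx p *m al) by rewrite mulKVmx.
rewrite /tangent mul_piF_sharp //; set t := dot _ _; set z := _ - _.
exists (2 * \det p * t); exists ((2 * \det p) *: z).
by rewrite scalerDr scale_scalar_mx hatZ.
Qed.

(* A solution [al] of [pi^# al = v], for [p^T v = t + hat z]. *)
Definition flat p (t : R) z : 'M[R]_3 :=
  p *m ((- (2 * r * \det p)^-1) *: (z^T *m F 0 - (t / 2) *: hat (F 0))).

Lemma piF_sharp_flat p v t z : \det p != 0 -> p^T *m v = t%:M + hat z ->
  piF_sharp lam mu F p (flat p t z) = v.
Proof.
move=> p0 vE; have pu : p^T \in unitmx by rewrite unitmx_tr unitmxE unitfE.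
apply: (can_inj (mulKmx pu)); rewrite vE mul_piF_sharp //; set c := - _.
have rE := dot_frame mu0 FP 0 0; rewrite eqxx mulr1 -/r in rE.
(* Here [axial (hat f) = 2 *: f], which is why [flat] contains [t / 2]. *)
have axE : axial (c *: (z^T *m F 0 - (t / 2) *: hat (F 0))) =
    c *: (cross (F 0) z - t *: F 0).
  by move: (F 0) => f; apply: row3P;
    rewrite /axial /cross /hat !mxE /= !big_ord1 !mxE /=; field.
have trE : \tr (c *: (z^T *m F 0 - (t / 2) *: hat (F 0))) = c * dot (F 0) z.
  by rewrite /mxtrace sum3 /dot /hat !mxE /= !big_ord1 !mxE /=; ring.
rewrite axE trE dotZr.
have -> : dot (F 0) (cross (F 0) z - t *: F 0) = - (t * r).
  by rewrite -rE /dot /cross !mxE /=; ring.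
have -> : cross (F 0) (c *: (cross (F 0) z - t *: F 0)) - (c * dot (F 0) z) *: F 0 =
    (- (c * r)) *: z.
  by rewrite -rE; mx3; ring.
have cE : 2 * \det p * (c * r) = - 1.
  by rewrite /c; field; rewrite p0 r_neq0.
rewrite scalerDr scale_scalar_mx; congr (_%:M + _).
  by transitivity (- (2 * \det p * (c * r)) * t); [ring | rewrite cE opprK mul1r].
by rewrite -hatZ scalerA mulrN cE opprK scale1r.
Qed.

(** In terms of traces and axial vectors the bivector is a skew pairing of the trace with the
    [F 0]-component, plus a triple product with [F 0]. *)
Lemma piF_antisym p al be : \det p != 0 ->
  piF lam mu F p al be = - piF lam mu F p be al.
Proof.
move=> p0; have pu : p \in unitmx by rewrite unitmxE unitfE.
rewrite -[al](mulKVmx pu) -[be](mulKVmx pu).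
move: (invmx p *m al) (invmx p *m be) => Y Z.
have E Y' Z' : piF lam mu F p (p *m Y') (p *m Z') = 2 * \det p *
    (dot (F 0) (axial Y') * \tr Z' + dot (cross (F 0) (axial Y') - \tr Y' *: F 0)
      (axial Z')).
  rewrite (piF_pairing lam0 mu0) pairing_trace trmx_mul -mulmxA mul_piF_sharp //.
  rewrite -scalemxAr mxtraceZ; congr (_ * _);
    rewrite mulmxDr mul_mx_scalar mxtraceD mxtraceZ mxtrace_tr.
  by rewrite mxtrace_mul_hat.
have eqN (a b c d : R) : a = c -> b = d -> c = - d -> a = - b by move=> -> ->.
apply: (eqN _ _ _ _ (E Y Z) (E Z Y));
  move: (F 0) (axial Y) (axial Z) (\tr Y) (\tr Z) => f y z ty tz.
by rewrite /dot /cross !mxE /=; ring.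
Qed.

Lemma leaf_formE p v w t t' z z' : \det p != 0 ->
  p^T *m v = t%:M + hat z -> p^T *m w = t'%:M + hat z' ->
  leaf_form lam mu F p v w =
    4 * mu / \det p * dot (F 0) (cross z z' + t' *: z - t *: z').
Proof.
move=> p0 vE wE; rewrite /leaf_form.
have vS := piF_sharp_flat p0 vE; have wS := piF_sharp_flat p0 wE.
have := @xgetPex _ 0 [set al | piF_sharp lam mu F p al = v] (ex_intro _ _ vS).
have := @xgetPex _ 0 [set al | piF_sharp lam mu F p al = w] (ex_intro _ _ wS).
move: (xget _ _) (xget _ _) => be al /= beE alE.
(* The covectors picked by [xget] enter only through their images: [al] is traded for the [flat]
   covector of [v], and skew-symmetry then lets [be] be evaluated by its image [w]. *)
rewrite (piF_pairing lam0 mu0) alE -vS -(piF_pairing lam0 mu0) piF_antisym //.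
rewrite (piF_pairing lam0 mu0) beE pairing_trace /flat trmx_mul -mulmxA wE.
have -> : 4 * mu / \det p = (2 * r * \det p)^-1.
  by rewrite /r; field; rewrite p0 gt_eqF.
rewrite linearZ /= -scalemxAl mxtraceZ mulNr opprK; congr (_ * _).
by move: (F 0) => f; rewrite /mxtrace sum3 /dot /cross /hat !(mxE, sum3, big_ord1) /=;
  field.
Qed.

End Sharp.

(** * Smooth maps *)

Section SmoothMaps.
Context {R : realType}.
Implicit Types V W : normedModType R.

(** The difference vanishes near [x], hence is negligible there and has differential 0. *)
Lemma near_eq_differentiable V W (f g : V -> W) x :
  {near x, f =1 g} -> differentiable f x -> differentiable g x.
Proof.
move=> fg df.
suff : differentiable (g \- f) x.
  move=> dgf; have -> : g = (g \- f) + f by apply/funext => y; rewrite addrfctE /= subrK.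
  exact: differentiableD.
have dE : (g \- f) \o shift x = cst ((g \- f) x) + (0 : V -> W) +o_ 0 id.
  apply/eqaddoP => _ /posnumP[e].
  have [d /= d0 fgd] := (nbhs_normP _ _).1 fg.
  apply/nbhs_normP; exists d => //= h /=; rewrite /ball_ /= sub0r normrN => hd.
  have e0 : g (h + x) = f (h + x).
    by apply/esym/fgd; rewrite /ball_ /= opprD addrC subrK normrN.
  by rewrite !fctE /= e0 (nbhs_singleton fg) !subrr addr0 subrr normr0.
have c0 : continuous (0 : V -> W) by exact: cst_continuous.
have D0 := @diff_unique R V W (g \- f) \0 x c0 dE.
by apply/diff_locallyP; rewrite D0.
Qed.

Lemma Ck_eq V W k (U : set V) (f g : V -> W) : open U ->
  (forall x, U x -> f x = g x) -> Ck k U f -> Ck k U g.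
Proof.
move=> oU; elim: k f g => [|k IH] f g fg; last first.
  have nfg x : U x -> {near x, f =1 g}.
    by move=> Ux; apply: filterS (open_nbhs_nbhs (conj oU Ux)).
  move=> [df Dk]; split=> [x Ux|v].
    exact: near_eq_differentiable (nfg x Ux) (df x Ux).
  by apply: IH (Dk v) => x Ux; apply/near_eq_derive/nfg.
move=> /= cf x Ux; rewrite /prop_for /continuous_at -(fg x Ux).
apply: cvg_trans (cf x Ux); apply: near_eq_cvg.
by apply: filterS (open_nbhs_nbhs (conj oU Ux)) => y Uy; rewrite fg.
Qed.

Lemma CkS V W k (U : set V) (f : V -> W) : Ck k.+1 U f -> Ck k U f.
Proof.
elim: k f => [|k IH] f [df Dk].
  by move=> x /df; exact: differentiable_continuous.
by split=> // v; apply: IH; exact: Dk.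
Qed.

Lemma smooth_differentiable V W (U : set V) (f : V -> W) x :
  smooth_on U f -> U x -> differentiable f x.
Proof. by move=> /(_ 1%N)[df _]; exact: df. Qed.

Lemma smooth_derivable V W (U : set V) (f : V -> W) x v :
  smooth_on U f -> U x -> derivable f x v.
Proof. by move=> sf Ux; apply/diff_derivable/(smooth_differentiable sf). Qed.

Lemma smooth_derive V W (U : set V) (f : V -> W) v :
  smooth_on U f -> smooth_on U (fun x => 'D_v f x).
Proof. by move=> sf k; have [_ Df] := sf k.+1; exact: Df. Qed.

Lemma smooth_eq V W (U : set V) (f g : V -> W) : open U ->
  (forall x, U x -> f x = g x) -> smooth_on U f -> smooth_on U g.
Proof. by move=> oU fg sf k; apply: Ck_eq (sf k). Qed.

Lemma Ck_cst V W k (U : set V) (c : W) : Ck k U (fun=> c).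
Proof.
elim: k c => [|k IH] c; first by move=> x _; exact: cst_continuous.
split=> [x _|v]; first exact: differentiable_cst.
rewrite (_ : (fun x : V => 'D_v (fun=> c) x) = fun=> 0); first exact: IH.
by apply/funext => x; rewrite derive_cst.
Qed.

Lemma smooth_cst V W (U : set V) (c : W) : smooth_on U (fun=> c).
Proof. by move=> k; exact: Ck_cst. Qed.

Lemma smooth_linear V (U : set V) (f : {linear V -> R^o}) :
  continuous f -> smooth_on U (f : V -> R).
Proof.
move=> cf [|k]; first by move=> x _; exact: cf.
split=> [x _|v]; first exact: (linear_differentiable (W' := R^o)).
rewrite (_ : (fun x : V => 'D_v (f : V -> R) x) = fun=> f v); first exact: Ck_cst.
by apply/funext => x; rewrite derive_lin.
Qed.

Lemma smooth_coord m n (U : set 'M[R]_(m, n)) i j : smooth_on U (fun A => A i j).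
Proof.
have fl : linear (fun A : 'M[R]_(m, n) => A i j : R^o) by move=> k x y; rewrite !mxE.
pose fL := GRing.isLinear.Build R 'M[R]_(m, n) R^o *:%R _ fl.
pose f : {linear 'M[R]_(m, n) -> R^o} := HB.pack (fun A : 'M[R]_(m, n) => A i j : R^o) fL.
exact: (@smooth_linear _ U f (@coord_continuous _ _ _ i j)).
Qed.

Lemma smooth_id (U : set R) : smooth_on U id.
Proof. exact: (@smooth_linear R U idfun (fun x => cvg_id)). Qed.

Lemma CkD V W k (U : set V) (f g : V -> W) : open U ->
  Ck k U f -> Ck k U g -> Ck k U (fun x => f x + g x).
Proof.
move=> oU; elim: k f g => [|k IH] f g.
  by move=> cf cg x Ux; apply: (@continuousD _ _ _ f g); [exact: cf|exact: cg].
move=> [df Df] [dg Dg]; split=> [x Ux|v].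
  by apply: differentiableD; [exact: df|exact: dg].
apply: Ck_eq oU _ (IH _ _ (Df v) (Dg v)) => x Ux /=.
by rewrite deriveD //; apply/diff_derivable; [exact: df|exact: dg].
Qed.

Lemma smoothD V W (U : set V) (f g : V -> W) : open U ->
  smooth_on U f -> smooth_on U g -> smooth_on U (fun x => f x + g x).
Proof. by move=> oU sf sg k; exact: CkD. Qed.

Lemma smooth_sum V W (U : set V) (I : Type) (r : seq I) (f : I -> V -> W) : open U ->
  (forall i, smooth_on U (f i)) -> smooth_on U (fun x => \sum_(i <- r) f i x).
Proof.
move=> oU sf; elim: r => [|i r IH].
  by under eq_fun do rewrite big_nil; exact: smooth_cst.
by under eq_fun do rewrite big_cons; exact: smoothD.
Qed.

Lemma CkM V k (U : set V) (f g : V -> R) : open U ->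
  Ck k U f -> Ck k U g -> Ck k U (fun x => f x * g x).
Proof.
move=> oU; elim: k f g => [|k IH] f g.
  by move=> cf cg x Ux; apply: (@continuousM _ _ f g); [exact: cf|exact: cg].
move=> Cf Cg; have [df Df] := Cf; have [dg Dg] := Cg; split=> [x Ux|v].
  by apply: differentiableM; [exact: df|exact: dg].
apply: Ck_eq oU _ (CkD oU (IH _ _ (CkS Cf) (Dg v)) (IH _ _ (CkS Cg) (Df v))) => x Ux /=.
by rewrite deriveM //; apply/diff_derivable; [exact: df|exact: dg].
Qed.

Lemma smoothM V (U : set V) (f g : V -> R) : open U ->
  smooth_on U f -> smooth_on U g -> smooth_on U (fun x => f x * g x).
Proof. by move=> oU sf sg k; exact: CkM. Qed.

Lemma smoothN V (U : set V) (f : V -> R) : open U ->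
  smooth_on U f -> smooth_on U (fun x => - f x).
Proof.
move=> oU sf; apply: (@smooth_eq _ _ U (fun x => -1 * f x)) => //.
  by move=> x _; rewrite mulN1r.
by apply: smoothM => //; exact: smooth_cst.
Qed.

Lemma smoothB V (U : set V) (f g : V -> R) : open U ->
  smooth_on U f -> smooth_on U g -> smooth_on U (fun x => f x - g x).
Proof. by move=> oU sf sg; apply: smoothD => //; exact: smoothN. Qed.

Lemma derive_comp1 V (phi : R -> R) (f : V -> R) x v :
  differentiable f x -> differentiable phi (f x) ->
  'D_v (phi \o f) x = 'D_1 phi (f x) * 'D_v f x.
Proof.
move=> df dphi; rewrite !deriveE //; last exact: differentiable_comp.
rewrite diff_comp //= -[X in 'd phi _ X = _]mulr1.
by rewrite [LHS]linearZ mulrC.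
Qed.

Lemma Ck_comp V k (J : set R) (U : set V) (phi : R -> R) (f : V -> R) :
  open U -> (forall x, U x -> J (f x)) ->
  Ck k J phi -> Ck k U f -> Ck k U (fun x => phi (f x)).
Proof.
move=> oU UJ; elim: k phi f UJ => [|k IH] phi f UJ.
  by move=> cphi cf x Ux; apply: continuous_comp; [exact: cf|exact/cphi/UJ].
move=> Cphi Cf; have [dphi Dphi] := Cphi; have [df Df] := Cf; split=> [x Ux|v].
  by apply: differentiable_comp; [exact: df|exact/dphi/UJ].
apply: Ck_eq oU _ (CkM oU (IH _ _ UJ (Dphi 1) (CkS Cf)) (Df v)) => x Ux /=.
by apply/esym/derive_comp1; [exact: df|exact/dphi/UJ].
Qed.

Lemma smooth_comp V (J : set R) (U : set V) (phi : R -> R) (f : V -> R) :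
  open U -> (forall x, U x -> J (f x)) ->
  smooth_on J phi -> smooth_on U f -> smooth_on U (fun x => phi (f x)).
Proof. by move=> oU UJ sphi sf k; apply: Ck_comp oU UJ (sphi k) (sf k). Qed.

(** Induction on [k] closes because the derivative of the inverse is a polynomial in the inverse and
    in a derivative of [f]; [smooth_sqrt] bootstraps in the same way. *)
Lemma CkV V k (U : set V) (f : V -> R) : open U ->
  (forall x, U x -> f x != 0) -> Ck k U f -> Ck k U (fun x => (f x)^-1).
Proof.
move=> oU f0; elim: k => [|k IH] Cf.
  by move=> x Ux; apply: (@continuousV _ _ f); [exact: f0|exact: Cf].
have {}IH := IH (CkS Cf); have [df Df] := Cf.
split=> [x Ux|v]; first by apply: differentiableV; [exact: df|exact: f0].
have C := CkM oU (CkM oU (Ck_cst k U (-1 : R^o)) (CkM oU IH IH)) (Df v).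
apply: Ck_eq oU _ C => x Ux /=.
rewrite deriveV; [|exact: f0|exact/diff_derivable/df].
by rewrite -invfM mulN1r -expr2.
Qed.

Lemma smoothV V (U : set V) (f : V -> R) : open U ->
  (forall x, U x -> f x != 0) ->
  smooth_on U f -> smooth_on U (fun x => (f x)^-1).
Proof. by move=> oU f0 sf k; exact: CkV. Qed.

Lemma smooth_sqrt V (U : set V) (f : V -> R) : open U ->
  (forall x, U x -> 0 < f x) ->
  smooth_on U f -> smooth_on U (fun x => Num.sqrt (f x)).
Proof.
move=> oU f0 sf; apply: (@smooth_comp _ [set x | 0 < x] _ Num.sqrt) => //.
have oP : open [set x : R | 0 < x] by exact: open_gt.
have dsqrt (x : R) : 0 < x -> differentiable (Num.sqrt : R -> R) x.
  by move=> x0; apply/derivable1_diffP; have [] := is_derive1_sqrt x0.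
move=> k; elim: k => [|k IH]; first by move=> x _; exact: sqrt_continuous.
split=> [x /dsqrt //|v].
have IH2 : Ck k [set x : R | 0 < x] (fun x => (2 * Num.sqrt x)^-1).
  apply: CkV => // [x /= x0|]; first by rewrite gt_eqF // mulr_gt0 // sqrtr_gt0.
  by apply: CkM => //; exact: Ck_cst.
have C := CkM oP IH2 (Ck_cst k _ (v : R^o)).
apply: Ck_eq oP _ C => x /= x0.
rewrite mulrC -derive_sqrt // !deriveE; [|exact: dsqrt|exact: dsqrt].
by rewrite -[X in _ = 'd _ _ X]mulr1 [RHS]linearZ.
Qed.

Lemma Ck_scalel V W k (U : set V) (f : V -> R) (w : W) : open U ->
  Ck k U f -> Ck k U (fun x => f x *: w).
Proof.
move=> oU; elim: k f => [|k IH] f.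
  by move=> cf x Ux; apply: cvgZr_tmp; exact: cf.
move=> [df Df]; split=> [x Ux|v]; first exact/differentiableZl/df.
apply: Ck_eq oU _ (IH _ (Df v)) => x Ux /=.
by rewrite !deriveE ?diffZl //; [exact/df|exact/differentiableZl/df|exact/df].
Qed.

Lemma smooth_mx V m n (U : set V) (f : V -> 'M[R]_(m, n)) : open U ->
  (forall i j, smooth_on U (fun x => f x i j)) -> smooth_on U f.
Proof.
move=> oU sf; rewrite (_ : f = fun x => \sum_i \sum_j f x i j *: delta_mx i j).
  apply: smooth_sum => // i; apply: smooth_sum => // j k.
  by apply: Ck_scalel => //; exact: sf.
by apply/funext => x; exact: matrix_sum_delta.
Qed.

Lemma smooth_entry V m n (U : set V) (f : V -> 'M[R]_(m, n)) i j : open U ->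
  smooth_on U f -> smooth_on U (fun x => f x i j).
Proof.
move=> oU sf k; move: f sf; elim: k => [|k IH] f sf.
  move=> x Ux; apply: (@continuous_comp _ _ _ f (fun A : 'M[R]_(m, n) => A i j)).
    exact: (sf 0%N x Ux).
  exact: coord_continuous.
split=> [x Ux|v].
  apply: (@differentiable_comp _ _ _ _ f (fun A : 'M[R]_(m, n) => A i j)).
    exact: (smooth_differentiable sf).
  exact: differentiable_coord.
apply: Ck_eq oU _ (IH _ (smooth_derive v sf)) => x Ux /=.
by rewrite derive_mx ?mxE //; apply: smooth_derivable sf Ux.
Qed.

Lemma smooth_mulmx V m n p (U : set V) (f : V -> 'M[R]_(m, n)) (g : V -> 'M[R]_(n, p)) :
  open U -> smooth_on U f -> smooth_on U g -> smooth_on U (fun x => f x *m g x).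
Proof.
move=> oU sf sg; apply: smooth_mx => // i j.
under eq_fun do rewrite mxE.
by apply: smooth_sum => // k; apply: smoothM => //; exact: smooth_entry.
Qed.

Lemma is_derive_line V W (f : V -> W) (y w : V) (t : R) :
  differentiable f (y + t *: w) ->
  is_derive t 1 (fun a : R => f (y + a *: w)) ('D_w f (y + t *: w)).
Proof.
move=> df; pose l : R -> V := cst y + ( *:%R ^~ w).
have ds : is_diff t ( *:%R ^~ w : R -> V) ( *:%R ^~ w) by exact: is_diff_scalel.
have dl : differentiable l t by apply: differentiableD.
have dfl : differentiable (f \o l) t by apply: differentiable_comp.
apply: DeriveDef; first exact: (@diff_derivable _ _ _ (f \o l)).
rewrite (@deriveE _ _ _ (f \o l)) // diff_comp //= deriveE //=; congr ('d f _ _).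
rewrite /l diffD //= diff_cst diff_val.
by apply: etrans (add0r _) _; exact: scale1r.
Qed.

Lemma is_derive_continuous1 (f : R -> R) (t d : R) :
  is_derive t 1 f d -> {for t, continuous f}.
Proof. by case=> /derivable1_diffP/differentiable_continuous. Qed.

Lemma MVT_is_derive (f df : R -> R) (h : R) : 0 < h ->
  (forall t, 0 <= t <= h -> is_derive t 1 f (df t)) ->
  exists2 t, 0 <= t <= h & f h - f 0 = df t * h.
Proof.
move=> h0 fd; have [||t th e] := @MVT R f df 0 h h0.
- by move=> t; rewrite in_itv /= => /andP[t0 th]; apply: fd; rewrite !ltW.
- apply: continuous_in_subspaceT => t; rewrite inE /= in_itv /= => th.
  exact: is_derive_continuous1 (fd t th).
exists t; last by rewrite e subr0.
by move: th; rewrite in_itv /= => /andP[t0 th]; rewrite !ltW.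
Qed.

(** The mean value theorem is applied along [w] to the difference in the direction [v], then along
    [v] to the derivative ['D_w f]. *)
Lemma second_difference V (U : set V) (f : V -> R) (x v w : V) (h : R) :
  0 < h -> smooth_on U f ->
  (forall a b, 0 <= a <= h -> 0 <= b <= h -> U (x + a *: v + b *: w)) ->
  exists a b, [/\ 0 <= a <= h, 0 <= b <= h &
    f (x + h *: v + h *: w) - f (x + h *: w) - (f (x + h *: v) - f x) =
    'D_v (fun y => 'D_w f y) (x + a *: v + b *: w) * h * h].
Proof.
move=> h0 sf xU; have hh : 0 <= h <= h by rewrite ltW /=.
have h00 : 0 <= (0 : R) <= h by rewrite lexx ltW.
have [b bh Eb] := @MVT_is_derive
  (fun t => f (x + h *: v + t *: w) - f (x + 0 *: v + t *: w))
  (fun t => 'D_w f (x + h *: v + t *: w) - 'D_w f (x + 0 *: v + t *: w)) h h0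
  (fun t th => is_deriveB (is_derive_line (smooth_differentiable sf (xU h t hh th)))
     (is_derive_line (smooth_differentiable sf (xU 0 t h00 th)))).
have [t th|a ah Ea] := @MVT_is_derive (fun t => 'D_w f (x + t *: v + b *: w))
  (fun t => 'D_v (fun y => 'D_w f y) (x + t *: v + b *: w)) h h0.
  rewrite addrAC; under eq_fun do rewrite addrAC.
  apply: is_derive_line; apply: smooth_differentiable (smooth_derive w sf) _.
  by rewrite addrAC; exact: xU.
exists a, b; split=> //; rewrite -Ea -Eb.
by rewrite !scale0r !addr0.
Qed.

(** Schwarz's theorem. On a small parallelogram the second difference is a value of either mixed
    derivative times [h * h]; by continuity both values are within [e / 2] of those at [x], where
    the derivatives would differ by [e]. *)
Lemma derive_commute V (U : set V) (f : V -> R) (x v w : V) : open U ->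
  smooth_on U f -> U x ->
  'D_v (fun y => 'D_w f y) x = 'D_w (fun y => 'D_v f y) x.
Proof.
move=> oU sf Ux; apply/eqP; rewrite -subr_eq0 -normr_le0 leNgt; apply/negP.
set Dvw := fun y => 'D_v (fun y => 'D_w f y) y.
set Dwv := fun y => 'D_w (fun y => 'D_v f y) y.
change (0 < `|Dvw x - Dwv x| -> False).
set e := `|_| => e0; have e2 : 0 < e / 2 by rewrite divr_gt0.
have cvw : {for x, continuous Dvw} by exact: (smooth_derive v (smooth_derive w sf) 0%N
  x Ux).
have cwv : {for x, continuous Dwv} by exact: (smooth_derive w (smooth_derive v sf) 0%N
  x Ux).
have n1 := open_nbhs_nbhs (conj oU Ux : open_nbhs x U).
have {}cvw := (cvgrPdist_lt _ _).1 cvw _ e2; have n2 := cvw (nbhs_filter x).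
have {}cwv := (cvgrPdist_lt _ _).1 cwv _ e2; have n3 := cwv (nbhs_filter x).
have [d /= d0 xd] := (nbhs_normP _ _).1 (filterI n1 (filterI n2 n3)).
have {}xd y : `|x - y| < d -> [/\ U y, `|Dvw x - Dvw y| < e / 2 & `|Dwv x - Dwv y| < e / 2].
  by move=> xy; have [Uy [lt1 lt2]] := xd y xy; split; [exact: Uy|exact: lt1|exact: lt2].
(* This keeps the parallelogram inside the ball of radius [d]; the summand 1 keeps the denominator
   positive when both directions vanish. *)
pose h := d / (1 + `|v| + `|w|) / 2.
have c0 : 0 < 1 + `|v| + `|w| by rewrite -addrA ltr_wpDr ?addr_ge0.
have h0 : 0 < h by rewrite !divr_gt0.
have hd a b : 0 <= a <= h -> 0 <= b <= h -> `|a *: v + b *: w| < d.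
  move=> /andP[a0 ah] /andP[b0 bh].
  apply: (@le_lt_trans _ _ (h * (1 + `|v| + `|w|))).
    rewrite (le_trans (ler_normD _ _)) // !normrZ !ger0_norm // !mulrDr.
    by rewrite lerD // ?ler_wpM2r // (le_trans (ler_wpM2r _ ah)) // lerDr mulr_ge0 // ltW.
  by rewrite /h mulrAC divfK ?gt_eqF // ltr_pdivrMr // ltr_pMr // ltr1n.
have P a b : 0 <= a <= h -> 0 <= b <= h ->
    [/\ U (x + a *: v + b *: w), `|Dvw x - Dvw (x + a *: v + b *: w)| < e / 2 &
      `|Dwv x - Dwv (x + a *: v + b *: w)| < e / 2].
  by move=> ah bh; apply: xd; rewrite -addrA opprD addNKr normrN; exact: hd.
have [|a [b [ah bh E1]]] := second_difference h0 sf (x := x) (v := v) (w := w).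
  by move=> a b ah bh; have [] := P a b ah bh.
have [|a' [b' [ah' bh' E2]]] := second_difference h0 sf (x := x) (v := w) (w := v).
  by move=> a' b' ah' bh'; rewrite addrAC; have [] := P b' a' bh' ah'.
(* The second difference is symmetric in [v] and [w]. *)
have E : Dvw (x + a *: v + b *: w) = Dwv (x + b' *: v + a' *: w).
  apply/(mulIf (lt0r_neq0 h0))/(mulIf (lt0r_neq0 h0)).
  apply: etrans (esym E1) _; rewrite [x + b' *: v + _]addrAC; apply: etrans E2.
  rewrite [x + h *: w + _]addrAC; ring.
have [_ lt1 _] := P a b ah bh; have [_ _ lt2] := P b' a' bh' ah'.
have : e < e / 2 + e / 2.
  apply: le_lt_trans (ltrD lt1 lt2); rewrite E [X in _ + X]distrC.
  apply: le_trans (ler_normD _ _); rewrite /e le_eqVlt; apply/orP; left.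
  by apply/eqP; congr `|_|; rewrite addrA subrK.
by rewrite -splitr ltxx.
Qed.

End SmoothMaps.

(** * The Cayley parametrisation of rotations *)

Section PointwiseDerive.
Context {R : realType} {V : normedModType R}.
Implicit Types (f g : V -> R) (u v : V).

Lemma is_deriveD_fun f g u v df dg :
  is_derive u v f df -> is_derive u v g dg ->
  is_derive u v (fun z => f z + g z) (df + dg).
Proof. exact: is_deriveD. Qed.

Lemma is_deriveM_fun f g u v df dg :
  is_derive u v f df -> is_derive u v g dg ->
  is_derive u v (fun z => f z * g z) (df * g u + f u * dg).
Proof.
by move=> df' dg'; apply: is_derive_eq (is_deriveM df' dg') _; rewrite addrC mulrC.
Qed.

Lemma is_deriveN_fun f u v df :
  is_derive u v f df -> is_derive u v (fun z => - f z) (- df).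
Proof. exact: is_deriveN. Qed.

Lemma is_deriveV_fun f u v df : f u != 0 ->
  is_derive u v f df -> is_derive u v (fun z => (f z)^-1) (- (df / f u ^+ 2)).
Proof.
move=> f0 [fv <-]; apply: DeriveDef; first exact: derivableV.
by rewrite deriveV // scaleNr mulrC.
Qed.

Lemma is_derive_cst_fun u v (c : R) : is_derive u v (fun=> c) 0.
Proof. exact: is_derive_cst. Qed.

Lemma is_derive_sum3 (h : 'I_3 -> V -> R) u v (dh : 'I_3 -> R) :
  (forall k, is_derive u v (h k) (dh k)) ->
  is_derive u v (fun z => \sum_k h k z) (\sum_k dh k).
Proof.
move=> hd; under eq_fun do rewrite sum3; rewrite sum3.
by apply: is_deriveD_fun => //; exact: is_deriveD_fun.
Qed.

Lemma is_derive_mx m n (f : V -> 'M[R]_(m, n)) u v (df : 'M[R]_(m, n)) :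
  (forall i j, is_derive u v (fun z => f z i j) (df i j)) -> is_derive u v f df.
Proof.
move=> fd; have dv : derivable f u v by apply/derivable_mxP => i j; have [] := fd i j.
by apply: DeriveDef => //; rewrite derive_mx //; apply/matrixP => i j;
  rewrite mxE derive_val.
Qed.

Lemma is_derive_entry m n (f : V -> 'M[R]_(m, n)) u v (df : 'M[R]_(m, n)) i j :
  is_derive u v f df -> is_derive u v (fun z => f z i j) (df i j).
Proof.
move=> [dv <-]; apply: DeriveDef; first exact: (derivable_mxP _ _ _).1 dv i j.
by rewrite derive_mx // mxE.
Qed.

Lemma is_derive_mulmx m n (f : V -> 'M[R]_(m, 3)) (g : V -> 'M[R]_(3, n)) u v
    (df : 'M[R]_(m, 3)) (dg : 'M[R]_(3, n)) :
  is_derive u v f df -> is_derive u v g dg ->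
  is_derive u v (fun z => f z *m g z) (df *m g u + f u *m dg).
Proof.
move=> fd gd; apply: is_derive_mx => i j; under eq_fun do rewrite mxE.
rewrite !mxE -big_split /=; apply: is_derive_sum3 => k.
by apply: is_deriveM_fun; exact: is_derive_entry.
Qed.

End PointwiseDerive.

Section Cayley.
Context {R : realType}.
Implicit Types (x d e : 'rV[R]_3) (Q : 'M[R]_3).

Lemma nsq_gt0 x : 0 < 1 + dot x x.
Proof. by rewrite ltr_wpDr // /dot !addr_ge0 // -expr2 sqr_ge0. Qed.

Lemma nsq_neq0 x : 1 + dot x x != 0.
Proof. by rewrite gt_eqF ?nsq_gt0. Qed.

(* The rotation by the unit quaternion [(1 + x) / |1 + x|]. *)
Definition cay x : 'M[R]_3 := (1 + dot x x)^-1 *: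
  ((1 - dot x x)%:M + 2 *: (x^T *m x) + 2 *: hat x).

(* The body angular velocity of [cay] at [x] in the direction [d]. *)
Definition omega x d : 'rV[R]_3 := (2 / (1 + dot x x)) *: (d - cross x d).

Lemma cay_entry x i j : cay x i j = (1 + dot x x)^-1 *
  ((1 - dot x x) * (i == j)%:R + 2 * (x 0 i * x 0 j) + 2 * hat x i j).
Proof. by rewrite /cay !mxE big_ord1 !mxE mulr_natr. Qed.

Lemma cay_orth x : (cay x)^T *m cay x = 1%:M.
Proof.
have n0 := nsq_neq0 x; apply/matrixP => i j;
  rewrite mxE sum3 ![(cay x)^T _ _]mxE !cay_entry mxE.
move: n0; rewrite /hat !mxE /dot.
by elim/ord3P: i; elim/ord3P: j => /=; move: (x 0 0) (x 0 1) (x 0 2) => a b c n0;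
  field; exact: n0.
Qed.

Lemma det_cay x : \det (cay x) = 1.
Proof.
have := nsq_neq0 x; rewrite det3 !cay_entry /hat !mxE /= /dot.
by move: (x 0 0) (x 0 1) (x 0 2) => a b c n0; field; exact: n0.
Qed.

Lemma trace_cay x : 1 + \tr (cay x) = 4 / (1 + dot x x).
Proof.
have := nsq_neq0 x; rewrite /mxtrace sum3 !cay_entry /hat !mxE /= /dot.
by move: (x 0 0) (x 0 1) (x 0 2) => a b c n0; field; exact: n0.
Qed.

Lemma axial_cay x : axial (cay x) = (4 / (1 + dot x x)) *: x.
Proof.
have n0 := nsq_neq0 x; apply: row3P; move: n0;
  rewrite /axial !mxE /= ?big_ord1 ?mxE /= /dot;
move: (x 0 0) (x 0 1) (x 0 2) => a b c n0; field; exact: n0.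
Qed.

(** For angle [theta] and unit axis [n], the Cayley vector is [tan (theta / 2)] times [n], while
    [1 + \tr Q] is [4 cos^2 (theta / 2)] and [axial Q] is [2 sin theta] times [n]. The rotations
    without a Cayley vector are the half-turns, where [1 + \tr Q = 0]. *)
Definition cay_inv Q : 'rV[R]_3 := (1 + \tr Q)^-1 *: axial Q.

Lemma cayK : cancel cay cay_inv.
Proof.
move=> x; rewrite /cay_inv axial_cay trace_cay scalerA mulVf ?scale1r //.
by rewrite mulf_neq0 ?invr_neq0 ?nsq_neq0.
Qed.

Lemma rotation_cross Q x y : Q^T *m Q = 1%:M -> \det Q = 1 ->
  cross (x *m Q) (y *m Q) = cross x y *m Q.
Proof.
move=> QQ dQ; have := mul_cross Q^T x y; rewrite det_tr dQ scale1r trmxK => <-.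
by rewrite -mulmxA QQ mulmx1.
Qed.

(** In Rodrigues' formula both sides are [4 sin^2 theta] times the projection onto the axis. *)
Lemma rotation_axial Q i j : Q^T *m Q = 1%:M -> \det Q = 1 ->
  axial Q 0 i * axial Q 0 j =
  (1 + \tr Q) * (Q i j + Q j i + (1 - \tr Q) * (i == j)%:R).
Proof.
move=> QQ dQ; have QQ' := mulmx1C QQ.
have dotr k l : \sum_a Q k a * Q l a = (k == l)%:R.
  by have := congr1 (fun A : 'M[R]_3 => A k l) QQ'; rewrite !mxE => <-;
    apply: eq_bigr => a _; rewrite mxE.
have dotc k l : \sum_a Q a k * Q a l = (k == l)%:R.
  by have := congr1 (fun A : 'M[R]_3 => A k l) QQ; rewrite !mxE => <-;
    apply: eq_bigr => a _; rewrite mxE.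
have cofE (k l : 'I_3) a : cross (row k Q) (row l Q) 0 a =
    (cross (delta_mx 0 k) (delta_mx 0 l) *m Q) 0 a.
  by rewrite !rowE rotation_cross.
have := (cofE 0 1 0, cofE 0 1 1, cofE 0 1 2, (cofE 1 2 0, cofE 1 2 1, cofE 1 2 2),
         (cofE 2 0 0, cofE 2 0 1, cofE 2 0 2)).
have := (dotr 0 0, dotr 0 1, dotr 0 2, (dotr 1 1, dotr 1 2, dotr 2 2)).
have := (dotc 0 0, dotc 0 1, dotc 0 2, (dotc 1 1, dotc 1 2, dotc 2 2)).
rewrite /axial /mxtrace !sum3 /cross !(mxE, sum3) /=.
case=> [[[c00 c01] c02] [[c11 c12] c22]].
case=> [[[r00 r01] r02] [[r11 r12] r22]].
case=> [[[[k2 k2'] k2''] [[k0 k0'] k0'']] [[k1 k1'] k1'']].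
(* With the products of entries as unknowns, the claim is a linear consequence of the orthonormality
   of rows and columns and of [Q] being its own cofactor matrix. *)
by elim/ord3P: i; elim/ord3P: j => /=; lra.
Qed.

Lemma cay_invK Q : Q^T *m Q = 1%:M -> \det Q = 1 -> 1 + \tr Q != 0 ->
  cay (cay_inv Q) = Q.
Proof.
move=> QQ dQ t0; have aE i j := rotation_axial i j QQ dQ.
set t := 1 + \tr Q in t0.
have nE : 1 + dot (cay_inv Q) (cay_inv Q) = 4 / t.
  rewrite /cay_inv dotZl dotZr /dot !aE /=; move: t0; rewrite -/t => t0.
  have -> : \tr Q = t - 1 by rewrite addrC addKr.
  have : Q 0 0 + Q 1 1 + Q 2 2 = t - 1 by rewrite /t /mxtrace sum3; ring.
  by move=> /(canRL (addrK _)) /(canRL (addrK _)) ->; field.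
apply/matrixP => i j; rewrite cay_entry nE.
have -> : 1 - dot (cay_inv Q) (cay_inv Q) = 2 - 4 / t by rewrite -nE; ring.
have hE : hat (cay_inv Q) i j = t^-1 * (Q i j - Q j i).
  by rewrite /cay_inv -/t hatZ mxE; congr (_ * _); elim/ord3P: i; elim/ord3P: j;
    rewrite /hat /axial !mxE /=; ring.
have cE k : cay_inv Q 0 k = t^-1 * axial Q 0 k by rewrite /cay_inv mxE.
rewrite hE !cE mulrACA aE -/t (_ : 1 - \tr Q = 2 - t); last by rewrite /t; ring.
by field; rewrite t0.
Qed.

Lemma is_derive_dotxx (V : normedModType R) (x : V -> 'rV[R]_3) u v d :
  is_derive u v x d ->
  is_derive u v (fun z => dot (x z) (x z)) (2 * dot (x u) d).
Proof.
move=> xd; have xj j := is_derive_entry 0 j xd.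
have xx j := is_deriveM_fun (xj j) (xj j).
apply: is_derive_eq (is_deriveD_fun (is_deriveD_fun (xx 0) (xx 1)) (xx 2)) _.
by rewrite /dot; ring.
Qed.

Lemma is_derive_nsqV (V : normedModType R) (x : V -> 'rV[R]_3) u v d :
  is_derive u v x d ->
  is_derive u v (fun z => (1 + dot (x z) (x z))^-1)
    (- (2 * dot (x u) d / (1 + dot (x u) (x u)) ^+ 2)).
Proof.
move=> xd; have dn := @is_deriveV_fun _ _ (fun z => 1 + dot (x z) (x z)) u v _
  (nsq_neq0 (x u)) (is_deriveD_fun (is_derive_cst_fun u v 1) (is_derive_dotxx xd)).
by apply: is_derive_eq dn _; rewrite add0r.
Qed.

Lemma is_derive_cay (V : normedModType R) (x : V -> 'rV[R]_3) u v d :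
  is_derive u v x d ->
  is_derive u v (fun z => cay (x z)) (cay (x u) *m hat (omega (x u) d)).
Proof.
move=> xd; have xj j := is_derive_entry 0 j xd.
have dd := is_derive_dotxx xd; have dn := is_derive_nsqV xd.
have dh i j : is_derive u v (fun z => hat (x z) i j) (hat d i j).
  rewrite /hat mxE; under eq_fun do rewrite mxE.
  by elim/ord3P: i; elim/ord3P: j => /=;
    first [exact: is_derive_cst_fun | exact: is_deriveN_fun | exact: xj].
apply: is_derive_mx => i j; under eq_fun do rewrite cay_entry.
have c k := is_derive_cst_fun u v k.
have d1 := is_deriveM_fun (is_deriveD_fun (c 1) (is_deriveN_fun dd)) (c (i == j)%:R).
have d2 := is_deriveM_fun (c 2) (is_deriveM_fun (xj i) (xj j)).
have d3 := is_deriveM_fun (c 2) (dh i j).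
apply: is_derive_eq (is_deriveM_fun dn (is_deriveD_fun (is_deriveD_fun d1 d2) d3)) _.
move=> {d1 d2 d3 c}; rewrite [RHS]mxE sum3 !cay_entry.
have := nsq_neq0 (x u); move: (x u) => y; rewrite /omega /hat /cross !mxE /= /dot.
by elim/ord3P: i; elim/ord3P: j => /=;
  move: (y 0 0) (y 0 1) (y 0 2) (d 0 0) (d 0 1) (d 0 2) => a b c e f g n0; field; exact: n0.
Qed.

Lemma is_derive_omega (V : normedModType R) (x : V -> 'rV[R]_3) u v d e :
  is_derive u v x d ->
  is_derive u v (fun z => omega (x z) e)
    ((- (4 * dot (x u) d / (1 + dot (x u) (x u)) ^+ 2)) *: (e - cross (x u) e) -
     (2 / (1 + dot (x u) (x u))) *: cross d e).
Proof.
move=> xd; have xj j := is_derive_entry 0 j xd.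
have c k := is_derive_cst_fun u v k.
have dc j : is_derive u v (fun z => cross (x z) e 0 j) (cross d e 0 j).
  rewrite /cross mxE; under eq_fun do rewrite mxE.
  have E k l : is_derive u v (fun z => x z 0 k * e 0 l) (d 0 k * e 0 l).
    by apply: is_derive_eq (is_deriveM_fun (xj k) (c (e 0 l))) _; rewrite mulr0 addr0.
  by elim/ord3P: j => /=; exact: is_deriveD_fun (E _ _) (is_deriveN_fun (E _ _)).
have dn := is_derive_nsqV xd.
apply: is_derive_mx => i j; rewrite [i]ord1.
have oE z : omega z e 0 j = 2 * (1 + dot z z)^-1 * (e 0 j - cross z e 0 j).
  by rewrite /omega !mxE.
under eq_fun do rewrite oE.
have dj := is_deriveM_fun (is_deriveM_fun (c 2) dn) (is_deriveD_fun (c (e 0 j))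
  (is_deriveN_fun (dc j))).
apply: is_derive_eq dj _; rewrite !mxE.
by field; exact: nsq_neq0.
Qed.

(** By [is_derive_omega], [dom d e] is the derivative in the direction [d] of [omega] evaluated at
    the constant field [e], so this is the structure equation of SO(3). *)
Lemma maurer_cartan x d e :
  let dom d e := (- (4 * dot x d / (1 + dot x x) ^+ 2)) *: (e - cross x e) -
     (2 / (1 + dot x x)) *: cross d e in
  dom d e - dom e d = - cross (omega x d) (omega x e).
Proof.
have n0 := nsq_neq0 x; rewrite /= /omega.
apply: row3P; move: n0; entries;
move: (x 0 0) (x 0 1) (x 0 2) (d 0 0) (d 0 1) (d 0 2) (e 0 0) (e 0 1) (e 0 2);
by move=> x0 x1 x2 d0 d1 d2 e0 e1 e2 n0; field; exact: n0.
Qed.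

Lemma omega_eq0 x d : omega x d = 0 -> d = 0.
Proof.
rewrite /omega => /eqP;
  rewrite scaler_eq0 mulf_eq0 invr_eq0 (negbTE (nsq_neq0 x)) pnatr_eq0 /=.
move=> /eqP dx; have : dot d d = 0.
  transitivity (dot (d - cross x d) d); first by rewrite /dot /cross !mxE /=; ring.
  by rewrite dx /dot !mxE !mul0r !addr0.
rewrite /dot -!expr2 => /eqP; rewrite !paddr_eq0 ?addr_ge0 ?sqr_ge0 // !sqrf_eq0.
by move=> /andP[/andP[/eqP d0 /eqP d1] /eqP d2]; apply: row3P; rewrite mxE.
Qed.

Lemma omegaD x d e : omega x (d + e) = omega x d + omega x e.
Proof. by rewrite /omega; mx3; ring. Qed.

Lemma omegaZ x (k : R) d : omega x (k *: d) = k *: omega x d.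
Proof. by rewrite /omega; mx3; ring. Qed.

End Cayley.

(** * Cholesky factorisation *)

Section OpenPreimage.
Context {R : realType}.
Implicit Types V W : normedModType R.

Lemma open_setI_preimage V (U : set V) (f : V -> R) (D : set R) :
  open U -> smooth_on U f -> open D -> open [set x | U x /\ D (f x)].
Proof.
move=> oU sf oD; rewrite openE => x [Ux Dx].
apply: filterI; first exact: open_nbhs_nbhs (conj oU Ux).
have cf := sf 0%N x Ux; apply: cf; exact: open_nbhs_nbhs (conj oD Dx).
Qed.

End OpenPreimage.

Section SquareRootCurve.
Context {R : realType} (G : 'M[R]_3) (e : bool).
Context (GT : G^T = G).

Let a t := G 0 0 + t.
Let b t := G 1 1 + t.
Let c t := G 2 2 + t.
Let m2 t := a t * b t - G 0 1 ^+ 2.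
Let m3 t := c t * m2 t - G 0 2 * (G 0 2 * b t - G 0 1 * G 1 2) -
  G 1 2 * (a t * G 1 2 - G 0 1 * G 0 2).
(** These are the leading principal minors, so by Sylvester's criterion [J] consists of the [t] for
    which [G + t%:M] is positive definite. *)
Let J : set R := [set t | [/\ 0 < a t, 0 < m2 t & 0 < m3 t]].

Let Gsym i j : G i j = G j i. Proof. by rewrite -{1}GT mxE. Qed.

(** Each leading minor at [t + d] is a polynomial in [d] whose coefficients are sums of principal
    minors at [t], all of them positive. *)
Lemma sqrt_curve_up t t' : J t -> t <= t' -> J t'.
Proof.
move=> [a0 m20 m30] tt.
have -> : t' = t + (t' - t) by rewrite addrC subrK.
have : 0 <= t' - t by rewrite subr_ge0.
move: (t' - t) => d d0.
have b0 : 0 < b t.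
  by rewrite -(pmulr_rgt0 _ a0); apply: lt_le_trans m20 _;
    rewrite /m2 lerBlDr lerDl sqr_ge0.
(* Positivity of the minors that are not leading comes from the Desnanot-Jacobi identity. *)
have ac : 0 < a t * c t - G 0 2 ^+ 2.
  rewrite -(pmulr_rgt0 _ m20).
  have -> : m2 t * (a t * c t - G 0 2 ^+ 2) = a t * m3 t + (a t * G 1 2 - G 0 1 * G 0
    2) ^+ 2.
    by rewrite /m3 /m2; ring.
  by rewrite ltr_wpDr ?sqr_ge0 // mulr_gt0.
have bc : 0 < b t * c t - G 1 2 ^+ 2.
  rewrite -(pmulr_rgt0 _ m20).
  have -> : m2 t * (b t * c t - G 1 2 ^+ 2) = b t * m3 t + (b t * G 0 2 - G 0 1 * G 1
    2) ^+ 2.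
    by rewrite /m3 /m2; ring.
  by rewrite ltr_wpDr ?sqr_ge0 // mulr_gt0.
have c0 : 0 < c t.
  by rewrite -(pmulr_rgt0 _ a0); apply: lt_le_trans ac _; rewrite lerBlDr lerDl sqr_ge0.
split.
- by rewrite /a addrA ltr_wpDr.
- have -> : m2 (t + d) = m2 t + (d * (a t + b t) + d ^+ 2) by rewrite /m2 /a /b; ring.
  by rewrite ltr_wpDr // addr_ge0 ?sqr_ge0 // mulr_ge0 // addr_ge0 // ltW.
- have -> : m3 (t + d) = m3 t + (d * (m2 t + (a t * c t - G 0 2 ^+ 2) + (b t * c t - G
  1 2 ^+ 2)) +
      d ^+ 2 * (a t + b t + c t) + d ^+ 3) by rewrite /m3 /m2 /a /b /c; ring.
  have X0 : 0 <= m2 t + (a t * c t - G 0 2 ^+ 2) + (b t * c t - G 1 2 ^+ 2).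
    by rewrite ltW // addr_gt0 // addr_gt0.
  have Y0 : 0 <= a t + b t + c t by rewrite ltW // addr_gt0 // addr_gt0.
  apply: ltr_wpDr => //; apply: addr_ge0; last exact: exprn_ge0.
  by apply: addr_ge0; [exact: mulr_ge0|apply: mulr_ge0 => //; exact: sqr_ge0].
Qed.

(** The leading minors of a Gram matrix are the squared length of the first column, the squared
    length of the cross product of the first two, and the squared determinant. *)
Lemma sqrt_curve_mem q t : \det q != 0 -> q^T *m q = G + t%:M -> J t.
Proof.
move=> q0 qE.
have E i j : \sum_k q k i * q k j = G i j + t *+ (i == j).
  have := congr1 (fun A : 'M[R]_3 => A i j) qE; rewrite !mxE => <-.
  by apply: eq_bigr => k _; rewrite mxE.
have := (E 0 0, E 0 1, E 0 2, (E 1 1, E 1 2, E 2 2));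
  rewrite !sum3 /= !mulr0n !mulr1n !addr0.
case=> [[[E00 E01] E02] [[E11 E12] E22]].
pose x : 'rV[R]_3 := \row_k q k 0; pose y : 'rV[R]_3 := \row_k q k 1;
  pose z : 'rV[R]_3 := \row_k q k 2.
have dE : \det q = dot z (cross x y) by rewrite det3 /dot /cross /x /y /z !mxE /=; ring.
have sq_gt0 w : w != 0 -> 0 < dot w w.
  move=> w0; rewrite lt_neqAle /dot !addr_ge0 -?expr2 ?sqr_ge0 // andbT eq_sym.
  apply: contra w0; rewrite !paddr_eq0 ?addr_ge0 ?sqr_ge0 // !sqrf_eq0.
  by move=> /andP[/andP[/eqP d0 /eqP d1] /eqP d2]; apply/eqP/row3P; rewrite mxE.
split.
- rewrite /a -E00; have -> : q 0 0 * q 0 0 + q 1 0 * q 1 0 + q 2 0 * q 2 0 = dot x x.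
    by rewrite /dot !mxE.
  apply: sq_gt0; apply: contra q0 => /eqP x0; rewrite dE x0 /dot /cross !mxE /=.
  by apply/eqP; ring.
- have -> : m2 t = dot (cross x y) (cross x y).
    by rewrite /m2 /a /b -E00 -E11 -E01 /dot /cross !mxE /=; ring.
  apply: sq_gt0; apply: contra q0 => /eqP x0; rewrite dE x0 /dot !mxE /=.
  by apply/eqP; ring.
- have -> : m3 t = \det q ^+ 2.
    by rewrite /m3 /m2 /a /b /c -E00 -E11 -E22 -E01 -E02 -E12 det3; ring.
  by rewrite lt_neqAle sqr_ge0 andbT eq_sym sqrf_eq0.
Qed.

Let s1 t := Num.sqrt (a t).
Let s2 t := Num.sqrt (m2 t).
Let s3 t := Num.sqrt (m3 t).
(** The upper triangular Cholesky factor; the sign of its last diagonal entry selects the component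
    of the invertible matrices. *)
Let C t : 'M[R]_3 := \matrix_(j, k) nth 0 (nth [::]
  [:: [:: s1 t; G 0 1 / s1 t; G 0 2 / s1 t];
      [:: 0; s2 t / s1 t; (a t * G 1 2 - G 0 1 * G 0 2) / (s1 t * s2 t)];
      [:: 0; 0; (-1) ^+ e * (s3 t / s2 t)]] j) k.

Lemma sqrt_curve_smooth : open J /\ smooth_on J C.
Proof.
have sa (U : set R) : open U -> smooth_on U a.
  by move=> oU; apply: smoothD => //; [exact: smooth_cst|exact: smooth_id].
have sb (U : set R) : open U -> smooth_on U b.
  by move=> oU; apply: smoothD => //; [exact: smooth_cst|exact: smooth_id].
have sc (U : set R) : open U -> smooth_on U c.
  by move=> oU; apply: smoothD => //; [exact: smooth_cst|exact: smooth_id].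
have s_cst (U : set R) (k : R) : smooth_on U (fun=> k) by exact: smooth_cst.
have sm2 (U : set R) : open U -> smooth_on U m2.
  by move=> oU; apply: smoothB => //; apply: smoothM => //; [exact: sa|exact: sb].
have sm3 (U : set R) : open U -> smooth_on U m3.
  move=> oU; do 2?[apply: smoothB => //]; do 1?[apply: smoothM => //; first exact: sc].
  - exact: sm2.
  - by apply: smoothM => //; apply: smoothB => //; apply: smoothM => //; exact: sb.
  - by apply: smoothM => //; apply: smoothB => //; apply: smoothM => //; exact: sa.
have oP : open [set x : R | 0 < x] by exact: open_gt.
have oJ : open J.
  have -> : J = [set t | ([set t | ([set t | setT t /\ 0 < a t] t) /\ 0 < m2 t] t) /\ 0
    < m3 t].
    by apply/seteqP; split => t /=; [case=> *; do !split|case=> [[[]]] *; split].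
  have oT : open (setT : set R) by exact: openT.
  have o1 := open_setI_preimage oT (sa _ oT) oP.
  have o2 := open_setI_preimage o1 (sm2 _ o1) oP.
  exact: open_setI_preimage o2 (sm3 _ o2) oP.
split=> //.
have ss1 : smooth_on J s1 by apply: smooth_sqrt => [//|t []//|]; exact: sa.
have ss2 : smooth_on J s2 by apply: smooth_sqrt => [//|t []//|]; exact: sm2.
have ss3 : smooth_on J s3 by apply: smooth_sqrt => [//|t []//|]; exact: sm3.
have n1 t : J t -> s1 t != 0 by move=> [? ? ?]; rewrite gt_eqF // sqrtr_gt0.
have n2 t : J t -> s2 t != 0 by move=> [? ? ?]; rewrite gt_eqF // sqrtr_gt0.
have v1 := smoothV oJ n1 ss1; have v2 := smoothV oJ n2 ss2.
have v12 : smooth_on J (fun t => (s1 t * s2 t)^-1).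
  by apply: smoothV => // [t Jt|]; [rewrite mulf_neq0 ?n1 ?n2|exact: smoothM].
have saJ := sa _ oJ.
apply: smooth_mx => // i j; rewrite /C; under eq_fun do rewrite mxE.
elim/ord3P: i; elim/ord3P: j => /=; try exact: s_cst; try exact: ss1;
  try exact: (smoothM oJ (s_cst _ _) v1); try exact: (smoothM oJ ss2 v1).
- exact: smoothM oJ (smoothB oJ (smoothM oJ saJ (s_cst _ _)) (s_cst _ _)) v12.
- exact: smoothM oJ (s_cst _ _) (smoothM oJ ss3 v2).
Qed.

Lemma sqrt_curve_eq t : J t ->
  (C t)^T *m C t = G + t%:M /\ 0 < (-1) ^+ e * \det (C t).
Proof.
move=> [a0 m20 m30].
have E1 : s1 t * s1 t = a t by rewrite -expr2 sqr_sqrtr // ltW.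
have E2 : s2 t * s2 t = m2 t by rewrite -expr2 sqr_sqrtr // ltW.
have E3 : s3 t * s3 t = m3 t by rewrite -expr2 sqr_sqrtr // ltW.
have n1 : s1 t != 0 by rewrite gt_eqF // sqrtr_gt0.
have n2 : s2 t != 0 by rewrite gt_eqF // sqrtr_gt0.
have na : a t != 0 by rewrite gt_eqF.
have nm : m2 t != 0 by rewrite gt_eqF.
split; last first.
  have -> : (-1) ^+ e * \det (C t) = s3 t * ((-1) ^+ e * (-1) ^+ e).
    by rewrite det3 /C !mxE /=; field; rewrite n1 n2.
  by rewrite -expr2 sqrr_sign mulr1 sqrtr_gt0.
have eps : (-1) ^+ e * (s3 t / s2 t) * ((-1) ^+ e * (s3 t / s2 t)) = m3 t / m2 t.
  by rewrite mulrACA -expr2 sqrr_sign mul1r mulf_div E3 E2.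
have E12 : s1 t * s2 t * (s1 t * s2 t) = a t * m2 t by rewrite mulrACA E1 E2.
have c1 x : s1 t * (x / s1 t) = x by rewrite mulrC divfK.
have c1' x : x / s1 t * s1 t = x by rewrite divfK.
have c2 x : s2 t / s1 t * (x / (s1 t * s2 t)) = x / a t.
  by rewrite -E1; field; rewrite n1 n2.
have -> : (C t)^T *m C t = \matrix_(i, j) (C t 0 i * C t 0 j + C t 1 i * C t 1 j + C t
  2 i * C t 2 j).
  by apply/matrixP => i j; rewrite [LHS]mxE [RHS]mxE sum3;
    congr (_ * _ + _ * _ + _ * _); rewrite mxE.
apply/matrixP => i j; rewrite mxE [RHS]mxE [t%:M i j]mxE.
have [CE0 CE1 CE2] : [/\ C t 0 0 = s1 t, C t 0 1 = G 0 1 / s1 t & C t 0 2 = G 0 2 / s1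
  t] by rewrite /C !mxE.
have [CF0 CF1 CF2] : [/\ C t 1 0 = 0, C t 1 1 = s2 t / s1 t &
  C t 1 2 = (a t * G 1 2 - G 0 1 * G 0 2) / (s1 t * s2 t)] by rewrite /C !mxE.
have [CG0 CG1 CG2] : [/\ C t 2 0 = 0, C t 2 1 = 0 & C t 2 2 = (-1) ^+ e * (s3 t / s2
  t)] by rewrite /C !mxE.
elim/ord3P: i; elim/ord3P: j => /=;
  rewrite ?CE0 ?CE1 ?CE2 ?CF0 ?CF1 ?CF2 ?CG0 ?CG1 ?CG2 ?mul0r ?mulr0 ?addr0 ?mulr0n ?mulr1n.
- by rewrite E1.
- by rewrite c1.
- by rewrite c1.
- by rewrite c1' Gsym.
- rewrite !mulf_div E1 E2; rewrite -/(b t); move: na; rewrite /m2 => na; by field.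
- by rewrite mulf_div E1 c2; field.
- by rewrite c1' Gsym.
- by rewrite mulf_div E1 [X in _ + X]mulrC c2 (Gsym 2 1); field.
- rewrite eps !mulf_div E1 E12 -/(c t) /m3; move: na nm; rewrite /m2.
  by move: (a t) (b t) (c t) => x y z na nm; field; rewrite na nm.
Qed.

Lemma exists_sqrt_curve : exists (K : set R) (D : R -> 'M[R]_3), [/\ open K,
  forall t t', K t -> t <= t' -> K t', smooth_on K D,
  forall t, K t -> (D t)^T *m D t = G + t%:M /\ 0 < (-1) ^+ e * \det (D t) &
  forall q t, \det q != 0 -> q^T *m q = G + t%:M -> K t].
Proof.
have [oJ sC] := sqrt_curve_smooth; exists J, C; split => //.
- exact: sqrt_curve_up.
- exact: sqrt_curve_eq.
- exact: sqrt_curve_mem.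
Qed.

End SquareRootCurve.

(** * Smoothness of the Cayley map and of its inverse *)

Section SmoothCayley.
Context {R : realType}.
Implicit Types V : normedModType R.

Lemma smooth_dotxx V (U : set V) (x : V -> 'rV[R]_3) : open U ->
  smooth_on U x -> smooth_on U (fun z => dot (x z) (x z)).
Proof.
move=> oU sx; have sj j := smooth_entry 0 j oU sx.
by apply: smoothD => //; [apply: smoothD => //|]; exact: smoothM.
Qed.

Lemma smooth_cay V (U : set V) (x : V -> 'rV[R]_3) : open U ->
  smooth_on U x -> smooth_on U (fun z => cay (x z)).
Proof.
move=> oU sx; have sj j := smooth_entry 0 j oU sx.
have sd := smooth_dotxx oU sx.
have sc k := @smooth_cst R V R U k.
have sn := smoothV oU (fun z _ => nsq_neq0 (x z)) (smoothD oU (sc 1) sd).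
have sh i j : smooth_on U (fun z => hat (x z) i j).
  rewrite /hat; under eq_fun do rewrite mxE.
  by elim/ord3P: i; elim/ord3P: j => /=;
    first [exact: sc|exact: sj|exact: smoothN oU (sj _)].
apply: smooth_mx => // i j; under eq_fun do rewrite cay_entry.
apply: (smoothM oU sn); apply: (smoothD oU); last exact: smoothM oU (sc _) (sh i j).
apply: (smoothD oU); first exact: smoothM oU (smoothB oU (sc 1) sd) (sc _).
exact: smoothM oU (sc _) (smoothM oU (sj i) (sj j)).
Qed.

Lemma smooth_axial V (U : set V) (Q : V -> 'M[R]_3) : open U ->
  smooth_on U Q -> smooth_on U (fun z => axial (Q z)).
Proof.
move=> oU sQ; have sj i j := smooth_entry i j oU sQ.
apply: smooth_mx => // i j; rewrite /axial; under eq_fun do rewrite mxE.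
by elim/ord3P: j => /=; exact: smoothB oU (sj _ _) (sj _ _).
Qed.

Lemma smooth_trace V (U : set V) (Q : V -> 'M[R]_3) : open U ->
  smooth_on U Q -> smooth_on U (fun z => 1 + \tr (Q z)).
Proof.
move=> oU sQ; apply: (smoothD oU); first exact: smooth_cst.
by apply: (smooth_sum _ oU) => i; exact: smooth_entry.
Qed.

Lemma smooth_cay_inv V (U : set V) (Q : V -> 'M[R]_3) : open U ->
  (forall z, U z -> 1 + \tr (Q z) != 0) ->
  smooth_on U Q -> smooth_on U (fun z => cay_inv (Q z)).
Proof.
move=> oU Q0 sQ; apply: smooth_mx => // i j; rewrite /cay_inv; under eq_fun do rewrite mxE.
apply: (smoothM oU); first exact: smoothV oU Q0 (smooth_trace oU sQ).
exact: smooth_entry i j oU (smooth_axial oU sQ).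
Qed.

End SmoothCayley.

(** * Velocities of curves with Gram matrix in [G + R], and congruence of skew matrices *)

Section GramCurves.
Context {R : realType}.

Lemma smooth_is_derive (V W : normedModType R) (U : set V) (f : V -> W) x v :
  smooth_on U f -> U x -> is_derive x v f ('D_v f x).
Proof. by move=> sf Ux; apply: derivableP; exact: smooth_derivable sf Ux. Qed.

(** Together with [scalar_hat_decomp] this shows that the velocity of such a curve is tangent to the
    leaf. *)
Lemma derive_gram (t : R) (K : set R) (gam : R -> 'M[R]_3) (G : 'M[R]_3) (m : R -> R) :
  open K -> smooth_on K gam -> smooth_on K m -> K t ->
  (forall a, K a -> (gam a)^T *m gam a = G + (m a)%:M) ->
  (gam t)^T *m 'D_1 gam t + ((gam t)^T *m 'D_1 gam t)^T = ('D_1 m t)%:M.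
Proof.
move=> oK sg sm Kt gE;
  have dg : is_derive t 1 gam ('D_1 gam t) by exact: smooth_is_derive sg Kt.
have dm : is_derive t 1 m ('D_1 m t) by exact: smooth_is_derive sm Kt.
have dgT : is_derive t 1 (fun a : R => (gam a)^T) ('D_1 gam t)^T.
  apply: is_derive_mx => i j; rewrite mxE.
  under eq_fun do rewrite mxE; exact: is_derive_entry.
have [_ E1] := is_derive_mulmx dgT dg.
have dG : is_derive t 1 (fun a : R => G + (m a)%:M) (('D_1 m t)%:M : 'M[R]_3).
  apply: is_derive_mx => i j; under eq_fun do rewrite mxE [_%:M _ _]mxE.
  rewrite mxE; case: (i == j); rewrite ?mulr1n ?mulr0n.
    apply: is_derive_eq (is_deriveD_fun (is_derive_cst_fun t 1 (G i j)) dm) _.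
    by rewrite add0r.
  apply: is_derive_eq (is_deriveD_fun (is_derive_cst_fun t 1 (G i j))
    (is_derive_cst_fun t 1 0)) _.
  by rewrite add0r.
have [_ E2] := dG; rewrite trmx_mul trmxK addrC -E1 -E2; apply: near_eq_derive.
by apply: filterS (open_nbhs_nbhs (conj oK Kt)) => z Kz; exact: gE.
Qed.

End GramCurves.

Section Conjugation.
Context {R : realType}.
Implicit Types (A N : 'M[R]_3) (z w : 'rV[R]_3).

(** [mul_cross] in matrix form: congruence by [A] acts on axial vectors through the cofactor matrix,
    and the second hypothesis expresses this without an inverse. *)
Lemma hat_conj A z w : \det A != 0 -> z *m A^T = \det A *: w ->
  A^T *m hat w *m A = hat z.
Proof.
move=> A0 zA; apply: trmx_inj; apply/row_matrixP => i; rewrite !rowE row_mul_hatT.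
set x := delta_mx 0 i; rewrite !trmx_mul trmxK !mulmxA -mulmxA.
apply: (scalerI A0); rewrite -mul_cross zA crossZl -scalemxAl; congr (_ *: _).
by rewrite -[in RHS]row_mul_hatT !mulmxA.
Qed.

Lemma scalar_hat_decomp N (c : R) : N + N^T = c%:M ->
  N = (c / 2)%:M + hat ((1 / 2) *: axial N).
Proof.
move=> NE; have E i j : N i j + N j i = c *+ (i == j).
  by have := congr1 (fun A : 'M[R]_3 => A i j) NE; rewrite !mxE.
have := (E 0 0, E 0 1, E 0 2, (E 1 1, E 1 2, E 2 2)); rewrite /= !mulr0n !mulr1n.
case=> [[[e00 e01] e02] [[e11 e12] e22]].
by mx3; rewrite ?mulr0n ?mulr1n; lra.
Qed.

End Conjugation.

(** * Four translates of the Cayley chart cover SO(3) *)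

Section Flips.
Context {R : realType}.

(* The rotations by the quaternions [1, i, j, k]. *)
Definition flip (k : nat) : 'M[R]_3 := diag_mx (\row_(j < 3) nth 1 (nth [::]
  [:: [:: 1; 1; 1]; [:: 1; -1; -1]; [:: -1; 1; -1]; [:: -1; -1; 1]] k) j).

Lemma flip_tr k : (flip k)^T = flip k. Proof. exact: tr_diag_mx. Qed.

Lemma flipK k : flip k *m flip k = 1%:M.
Proof.
(* For [k] at least 4 the default value 1 makes [flip k] the identity, so the atlas only repeats its
   first chart. *)
rewrite /flip; case: k => [|[|[|[|k]]]]; apply: matrix3P; split;
  rewrite !(mxE, sum3) /= ?nth_nil ?mulr1n ?mulr0n; ring.
Qed.

Lemma det_flip k : \det (flip k) = 1.
Proof.
rewrite /flip det3; case: k => [|[|[|[|k]]]];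
  rewrite !mxE /= ?nth_nil ?mulr1n ?mulr0n; ring.
Qed.

Lemma sum_trace_flip (Q : 'M[R]_3) : \tr (flip 0 *m Q) + \tr (flip 1 *m Q) +
  \tr (flip 2 *m Q) + \tr (flip 3 *m Q) = 0.
Proof. by rewrite /mxtrace !sum3 /flip !(mxE, sum3) /= ?mulr1n ?mulr0n; ring. Qed.

(** The first four flips have sum 0, whereas four traces equal to -1 would have sum -4. *)
Lemma exists_trace_flip (Q : 'M[R]_3) : exists k, 1 + \tr (flip k *m Q) != 0.
Proof.
apply: contrapT => /forallNP E; have {}E k : 1 + \tr (flip k *m Q) = 0.
  by apply/eqP/negPn/negP; exact: E.
have := sum_trace_flip Q; have := (E 0%N, E 1%N, (E 2%N, E 3%N)).
by case=> [[e0 e1] [e2 e3]]; lra.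
Qed.

End Flips.

(** * Charts of a leaf *)

Section Charts.
Context {R : realType} (G : 'M[R]_3) (e : bool) (J : set R) (C : R -> 'M[R]_3).
Context (oJ : open J) (sC : smooth_on J C)
  (CE : forall t, J t -> (C t)^T *m C t = G + t%:M /\ 0 < (-1) ^+ e * \det (C t))
  (Jmem : forall q t, \det q != 0 -> q^T *m q = G + t%:M -> J t).
Implicit Types (u v : 'rV[R]_4) (x : 'rV[R]_3) (q : 'M[R]_3).

Definition gram_leaf : set 'M[R]_3 :=
  [set q | 0 < (-1) ^+ e * \det q /\ exists t, q^T *m q = G + t%:M].

Definition rot_part u : 'rV[R]_3 := \row_j [:: u 0 0; u 0 1; u 0 2]`_j.
Definition height u : R := u 0 3.
Definition chart_point x (t : R) : 'rV[R]_4 := \row_j [:: x 0 0; x 0 1; x 0 2; t]`_j.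

Lemma rot_chart_point x t : rot_part (chart_point x t) = x.
Proof. by apply: row3P; rewrite !mxE. Qed.

Lemma height_chart_point x t : height (chart_point x t) = t.
Proof. by rewrite /height mxE. Qed.

Lemma ord4P (P : 'I_4 -> Prop) : P 0 -> P 1 -> P 2 -> P 3 -> forall j, P j.
Proof.
move=> P0 P1 P2 P3 [[|[|[|[|//]]]] jP].
- by have -> : Ordinal jP = 0 by exact/val_inj.
- by have -> : Ordinal jP = 1 by exact/val_inj.
- by have -> : Ordinal jP = 2 by exact/val_inj.
- by have -> : Ordinal jP = 3 by exact/val_inj.
Qed.

Lemma chart_pointK u : chart_point (rot_part u) (height u) = u.
Proof. by apply/rowP; elim/ord4P; rewrite !mxE. Qed.

Definition chart_dom : set 'rV[R]_4 := [set u | J (height u)].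

Definition chart (k : nat) u : 'M[R]_3 := flip k *m cay (rot_part u) *m C (height u).

Lemma smooth_rot (U : set 'rV[R]_4) : open U -> smooth_on U rot_part.
Proof.
move=> oU; apply: smooth_mx => // i j; under eq_fun do rewrite mxE.
by elim/ord3P: j => /=; exact: smooth_coord.
Qed.

Lemma smooth_height (U : set 'rV[R]_4) : smooth_on U height.
Proof. exact: smooth_coord. Qed.

Lemma chart_dom_open : open chart_dom.
Proof.
have := open_setI_preimage openT (@smooth_height setT) oJ.
rewrite (_ : [set x | _] = chart_dom) //.
by apply/seteqP; split => [u [_ Ju]|u Ju]; [exact: Ju|split].
Qed.

Lemma smooth_C (U : set 'rV[R]_4) : open U -> U `<=` chart_dom ->
  smooth_on U (fun u => C (height u)).
Proof.
move=> oU UJ; apply: smooth_mx => // i j.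
apply: (@smooth_comp _ _ J U (fun t => C t i j) height) => //.
  exact: smooth_entry.
exact: smooth_height.
Qed.

Lemma smooth_chart k : smooth_on chart_dom (chart k).
Proof.
have oU := chart_dom_open.
apply: smooth_mulmx => //; last exact: smooth_C.
apply: smooth_mulmx => //; first exact: smooth_cst.
by apply: smooth_cay => //; exact: smooth_rot.
Qed.

Lemma rotation_trans k x : (flip k *m cay x)^T *m (flip k *m cay x) = 1%:M.
Proof. by rewrite trmx_mul flip_tr mulmxA -[_ *m _ *m flip k]mulmxA flipK mulmx1
  cay_orth. Qed.

Lemma chart_gram k u : chart_dom u -> (chart k u)^T *m chart k u = G + (height u)%:M.
Proof.
move=> Uu; rewrite /chart trmx_mul mulmxA -[_ *m (flip k *m _)]mulmxA rotation_trans mulmx1.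
by have [] := CE Uu.
Qed.

Lemma det_chart k u : \det (chart k u) = \det (C (height u)).
Proof. by rewrite /chart !det_mulmx det_flip det_cay !mul1r. Qed.

Lemma det_C_neq0 t : J t -> \det (C t) != 0.
Proof. by move=> /CE[_]; apply: contraTneq => ->; rewrite mulr0 ltxx. Qed.

Lemma det_chart_neq0 k u : chart_dom u -> \det (chart k u) != 0.
Proof. by move=> Uu; rewrite det_chart det_C_neq0. Qed.

Lemma C_unit t : J t -> C t \in unitmx.
Proof. by move=> Jt; rewrite unitmxE unitfE det_C_neq0. Qed.

Lemma gram_inj t t' : G + t%:M = G + t'%:M -> t = t'.
Proof.
move=> /addrI/(congr1 (fun A : 'M[R]_3 => A 0 0)).
by rewrite !mxE !mulr1n.
Qed.

(** The Gram matrix determines the height, after which the common factor [C] can be cancelled. *)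
Lemma chart_eq k l u v : chart_dom u -> chart_dom v ->
  chart l v = chart k u -> height v = height u /\
  cay (rot_part v) = flip l *m flip k *m cay (rot_part u).
Proof.
move=> Uu Uv E; have h : height v = height u.
  by apply: gram_inj; rewrite -(chart_gram l Uv) -(chart_gram k Uu) E.
split=> //; move: E; rewrite /chart h => /(can_inj (mulmxK (C_unit Uu))) E.
by rewrite -mulmxA -E mulmxA flipK mul1mx.
Qed.

Lemma chart_inj k u v : chart_dom u -> chart_dom v -> chart k u = chart k v -> u = v.
Proof.
move=> Uu Uv E; have [h] := chart_eq Uv Uu E;
  rewrite flipK mul1mx => /(can_inj (@cayK R)) x.
by rewrite -[u]chart_pointK -[v]chart_pointK h x.
Qed.

Lemma chart_leaf k u : chart_dom u -> gram_leaf (chart k u).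
Proof.
move=> Uu; split; last by exists (height u); exact: chart_gram.
by rewrite det_chart; have [] := CE Uu.
Qed.

Lemma gram_leaf_chart q t : 0 < (-1) ^+ e * \det q -> q^T *m q = G + t%:M ->
  [/\ J t, (q *m invmx (C t))^T *m (q *m invmx (C t)) = 1%:M &
      \det (q *m invmx (C t)) = 1].
Proof.
move=> dq qE; have q0 : \det q != 0 by apply: contraTneq dq => ->; rewrite mulr0 ltxx.
have Jt := Jmem q0 qE; have Cu := C_unit Jt; have [CCE dC] := CE Jt.
have orth : (q *m invmx (C t))^T *m (q *m invmx (C t)) = 1%:M.
  rewrite trmx_mul mulmxA -[_ *m q^T *m q]mulmxA qE -CCE mulmxA -[_ *m C t *m _]mulmxA.
  by rewrite mulmxV // mulmx1 trmx_inv mulVmx // unitmx_tr.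
split=> //; have : \det (q *m invmx (C t)) ^+ 2 = 1.
  by rewrite expr2 -{1}det_tr -det_mulmx orth det1.
move/eqP; rewrite sqrf_eq1 => /orP[/eqP //|/eqP dN].
have : 0 < \det (q *m invmx (C t)).
  have := divr_gt0 dq dC; rewrite -mulf_div divff ?signr_eq0 // mul1r.
  by rewrite det_mulmx det_inv.
by rewrite dN oppr_gt0 ltr10.
Qed.

Lemma gram_leaf_coord q t k : 0 < (-1) ^+ e * \det q -> q^T *m q = G + t%:M ->
  1 + \tr (flip k *m (q *m invmx (C t))) != 0 ->
  chart k (chart_point (cay_inv (flip k *m (q *m invmx (C t)))) t) = q.
Proof.
move=> dq qE tr0; have [Jt orth d1] := gram_leaf_chart dq qE.
rewrite /chart rot_chart_point height_chart_point cay_invK //; last 2 first.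
- by rewrite trmx_mul flip_tr mulmxA -[_ *m flip k *m flip k]mulmxA flipK mulmx1.
- by rewrite det_mulmx det_flip d1 mul1r.
by rewrite mulmxA flipK mul1mx mulmxKV // C_unit.
Qed.

Lemma gram_leaf_cover : gram_leaf = \bigcup_k (chart k @` chart_dom).
Proof.
apply/seteqP; split => [q [dq [t qE]]|q [k _ [u Uu <-]]]; last exact: chart_leaf.
have [Jt _ _] := gram_leaf_chart dq qE.
have [k tr0] := exists_trace_flip (q *m invmx (C t)).
exists k => //; exists (chart_point (cay_inv (flip k *m (q *m invmx (C t)))) t).
  by rewrite /chart_dom /= height_chart_point.
exact: gram_leaf_coord.
Qed.

(** A point of chart [k] lies in chart [l] iff the rotation [Q] taken relative to [flip l] is not a
    half-turn. This condition is open, and [cay_inv] of that rotation is the transition map. *)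
Lemma chart_transition k l : let D := chart_dom `&` chart k @^-1` (chart l @` chart_dom) in
  open D /\ exists2 tau, smooth_on D tau & forall u, D u -> chart_dom (tau u) /\ chart
    l (tau u) = chart k u.
Proof.
pose Q u := flip l *m flip k *m cay (rot_part u).
have sQ (U : set 'rV[R]_4) : open U -> smooth_on U Q.
  move=> oU; apply: (smooth_mulmx oU); first exact: smooth_cst.
  by apply: smooth_cay => //; exact: smooth_rot.
have DE : chart_dom `&` chart k @^-1` (chart l @` chart_dom) = [set u | chart_dom u /\
  1 + \tr (Q u) != 0].
  apply/seteqP; split => [u [Uu [v Uv E]]|u [Uu tr0]]; split=> //.
    have [_ cE] := chart_eq Uu Uv E.
    by rewrite /Q -cE trace_cay mulf_neq0 ?invr_neq0 ?nsq_neq0.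
  exists (chart_point (cay_inv (Q u)) (height u));
    first by rewrite /chart_dom /= height_chart_point.
  rewrite /chart rot_chart_point height_chart_point cay_invK //.
  - by rewrite /Q !mulmxA flipK mul1mx.
  - rewrite (_ : Q u = flip l *m (flip k *m cay (rot_part u))) ?[RHS]mulmxA //.
    by rewrite trmx_mul flip_tr mulmxA -[_ *m flip l *m flip l]mulmxA flipK mulmx1
      rotation_trans.
  - by rewrite /Q !det_mulmx !det_flip det_cay !mul1r.
rewrite DE; have oD : open [set u | chart_dom u /\ 1 + \tr (Q u) != 0].
  have s1 := smooth_trace chart_dom_open (sQ _ chart_dom_open).
  have oN : open [set x : R | x != 0] by exact: open_neq.
  exact: (open_setI_preimage chart_dom_open s1 oN).
split=> //; exists (fun u => chart_point (cay_inv (Q u)) (height u)).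
  apply: smooth_mx => // i j.
  apply: (@smooth_eq _ _ _ _ (fun u => [:: cay_inv (Q u) 0 0; cay_inv (Q u) 0 1;
    cay_inv (Q u) 0 2; height u]`_j)) => //.
    by move=> u _; rewrite [RHS]mxE.
  have sq : smooth_on [set u | chart_dom u /\ 1 + \tr (Q u) != 0] (fun u => cay_inv (Q u)).
    by apply: smooth_cay_inv => // [u []//|]; exact: sQ.
  by elim/ord4P: j => /=;
    [exact: smooth_entry|exact: smooth_entry|exact: smooth_entry|exact: smooth_height].
rewrite -DE => u [Uu [v Uv E]].
have [h cE] := chart_eq Uu Uv E; rewrite /Q -cE cayK -h chart_pointK.
by split.
Qed.

End Charts.

(** * Forms on the quaternions *)

Section QuaternionForms.
Context {R : realType}.
Implicit Types (f g z w : 'rV[R]_3) (y : 'rV[R]_4).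

Definition quat_form f : 'M[R]_4 := \matrix_(j, k) nth 0 (nth [::]
  [:: [:: 0; f 0 2; - f 0 1; f 0 0];
      [:: - f 0 2; 0; f 0 0; f 0 1];
      [:: f 0 1; - f 0 0; 0; f 0 2];
      [:: - f 0 0; - f 0 1; - f 0 2; 0]] j) k.

Lemma sum4 (V : nmodType) (t : 'I_4 -> V) : \sum_i t i = t 0 + t 1 + t 2 + t 3.
Proof.
rewrite !big_ord_recl big_ord0 addr0 !addrA.
by congr (_ + t _ + t _ + t _); exact/val_inj.
Qed.

(** The product of imaginary quaternions; the cross product has the opposite sign because
    composition is reversed on row vectors. *)
Lemma quat_form_mul f g : quat_form f *m quat_form g = - (dot f g)%:M - quat_form
  (cross f g).
Proof.
apply/matrixP => i j; rewrite mxE sum4 /quat_form /dot !mxE.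
by elim/ord4P: i; elim/ord4P: j => /=; rewrite ?mulr1n ?mulr0n; ring.
Qed.

Lemma quat_form_tr f : (quat_form f)^T = - quat_form f.
Proof. by apply/matrixP; elim/ord4P; elim/ord4P; rewrite /quat_form !mxE /=; ring. Qed.

Lemma quat_formZ (k : R) f : quat_form (k *: f) = k *: quat_form f.
Proof. by apply/matrixP; elim/ord4P; elim/ord4P; rewrite /quat_form !mxE /=; ring. Qed.

Lemma quat_formN f : quat_form (- f) = - quat_form f.
Proof. by rewrite -scaleN1r quat_formZ scaleN1r. Qed.

Lemma quat_formE f z w (t t' : R) : (chart_point z t *m quat_form f *m (chart_point w
  t')^T) 0 0 =
  dot f (cross z w + t' *: z - t *: w).
Proof. by rewrite !(mxE, sum4) /= /dot /cross !mxE /=; ring. Qed.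

Lemma invmx_eq n (A B : 'M[R]_n) : A *m B = 1%:M -> invmx A = B.
Proof.
by move=> AB; have [Au _] := mulmx1_unit AB; rewrite -[LHS]mulmx1 -AB mulKmx.
Qed.

Section Triple.
Context (r c : R) (f : 'I_3 -> 'rV[R]_3) (B : 'M[R]_4).
Context (r0 : r != 0) (c0 : c != 0) (Bu : B \in unitmx).
Context (fE : forall i j, dot (f i) (f j) = r * (i == j)%:R).
Let W i := c *: (B *m quat_form (f i) *m B^T).
Let Bi := invmx B.

Lemma quat_form_sq i : quat_form (f i) *m quat_form (f i) = (- r)%:M.
Proof.
rewrite quat_form_mul fE eqxx mulr1 (_ : cross _ _ = 0 *: f i); last by mx3; ring.
by rewrite quat_formZ scale0r subr0 -scalemx1 -[in RHS]scalemx1 scaleNr.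
Qed.

Lemma quat_form_anticomm i j : i != j -> quat_form (f i) *m quat_form (f j) = -
  (quat_form (f j) *m quat_form (f i)).
Proof.
move=> ij; rewrite !quat_form_mul !fE (negbTE ij) (eq_sym j) (negbTE ij) mulr0
  -scalemx1 scale0r.
by rewrite oppr0 !sub0r [cross (f j) _]crossC quat_formN opprK.
Qed.

Lemma form_inv i : invmx (W i) = (- (c * r)^-1) *: (Bi^T *m quat_form (f i) *m Bi).
Proof.
have BTu : B^T \in unitmx by rewrite unitmx_tr.
apply: invmx_eq; rewrite /W -scalemxAl -scalemxAr scalerA.
have -> : B *m quat_form (f i) *m B^T *m (Bi^T *m quat_form (f i) *m Bi) = (- r)%:M.
  rewrite !mulmxA -[_ *m B^T *m _]mulmxA /Bi trmx_inv mulmxV // mulmx1.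
  by rewrite -[B *m _ *m _]mulmxA quat_form_sq mul_mx_scalar -scalemxAl mulmxV // scalemx1.
by rewrite scale_scalar_mx; congr _%:M; field; rewrite r0 c0.
Qed.

Lemma form_unit i : W i \in unitmx.
Proof.
rewrite unitmxE /W detZ !det_mulmx det_tr !unitfE !mulf_neq0 ?expf_neq0 //.
- by rewrite -unitfE -unitmxE.
- have /mulmx1_unit[] : quat_form (f i) *m ((- r)^-1 *: quat_form (f i)) = 1%:M;
  last by rewrite unitmxE unitfE.
  by rewrite -scalemxAr quat_form_sq scale_scalar_mx mulVf // oppr_eq0.
- by rewrite -unitfE -unitmxE.
Qed.

Lemma form_antisym i : (W i)^T = - W i.
Proof.
by rewrite /W linearZ /= !trmx_mul trmxK quat_form_tr mulmxA mulmxN mulNmx scalerN.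
Qed.

(** After conjugation by [B^T] the endomorphism is [- r^-1] times a product of two anticommuting
    matrices, each of square [- r]. *)
Lemma form_sq i j : i != j ->
  (invmx (W j) *m W i) *m (invmx (W j) *m W i) = - 1%:M.
Proof.
move=> ij; have BTu : B^T \in unitmx by rewrite unitmx_tr.
have -> : invmx (W j) *m W i = (- r^-1) *: (Bi^T *m (quat_form (f j) *m quat_form (f
  i)) *m B^T).
  have E : Bi^T *m quat_form (f j) *m Bi *m (B *m quat_form (f i) *m B^T) =
      Bi^T *m (quat_form (f j) *m quat_form (f i)) *m B^T.
    by rewrite !mulmxA -[_ *m Bi *m B]mulmxA mulVmx // mulmx1.
  rewrite form_inv /W -scalemxAl -scalemxAr scalerA E; congr (_ *: _).
  by field; rewrite r0 c0.
rewrite -scalemxAl -scalemxAr scalerA.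
have -> : Bi^T *m (quat_form (f j) *m quat_form (f i)) *m B^T *m (Bi^T *m (quat_form (f
  j) *m quat_form (f i)) *m B^T) =
    (- (r * r))%:M.
  rewrite !mulmxA -[_ *m B^T *m Bi^T]mulmxA /Bi trmx_inv mulmxV // mulmx1 -!mulmxA.
  rewrite [quat_form (f i) *m (quat_form (f j) *m _)]mulmxA (quat_form_anticomm ij)
    mulNmx !mulmxN !mulmxA.
  rewrite -[_ *m quat_form (f j) *m quat_form (f j)]mulmxA quat_form_sq mul_mx_scalar
    -!scalemxAl.
  rewrite -[_ *m quat_form (f i) *m quat_form (f i)]mulmxA quat_form_sq mul_mx_scalar
    -!scalemxAl mulVmx //.
  by rewrite !scalemx1 !scale_scalar_mx -scalemx1 -scaleNr scalemx1; congr _%:M; ring.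
rewrite scale_scalar_mx (_ : _ * - (r * r) = -1); first by rewrite -scalemx1 scaleN1r.
by field.
Qed.

(** The quaternion relation [ijk = -1]: the three forms multiply to a scalar, which leaves only
    [B *m B^T]. *)
Lemma form_metric (phi : R) : cross (f 0) (f 1) = (phi / r) *: f 2 ->
  W 1 *m invmx (W 0) *m W 2 = (c * phi / r) *: (B *m B^T).
Proof.
move=> fx; have BTu : B^T \in unitmx by rewrite unitmx_tr.
rewrite form_inv /W -!scalemxAl -!scalemxAr !scalerA -scalemxAl scalerA.
have -> : B *m quat_form (f 1) *m B^T *m (Bi^T *m quat_form (f 0) *m Bi) *m (B *m
  quat_form (f 2) *m B^T) =
    B *m (quat_form (f 1) *m quat_form (f 0) *m quat_form (f 2)) *m B^T.
  rewrite !mulmxA -[_ *m B^T *m Bi^T]mulmxA /Bi trmx_inv mulmxV // mulmx1.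
  by rewrite -[_ *m invmx B *m B]mulmxA mulVmx // mulmx1.
have -> : quat_form (f 1) *m quat_form (f 0) *m quat_form (f 2) = (- phi)%:M.
  rewrite quat_form_anticomm // quat_form_mul fE mulr0 fx quat_formZ -scalemx1 scale0r
    oppr0 add0r opprK.
  by rewrite -scalemxAl quat_form_sq scale_scalar_mx; congr _%:M; field.
rewrite mul_mx_scalar -scalemxAl scalerA; congr (_ *: _); field.
by rewrite r0 c0.
Qed.

End Triple.

Lemma posdef_gram (k : R) (B : 'M[R]_4) : 0 < k -> B \in unitmx ->
  posdef (k *: (B *m B^T)).
Proof.
move=> k0 Bu; split=> [|x x0]; first by rewrite linearZ /= trmx_mul trmxK.
have -> : x *m (k *: (B *m B^T)) *m x^T = k *: ((x *m B) *m (x *m B)^T).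
  by rewrite -scalemxAr -scalemxAl trmx_mul !mulmxA.
rewrite mxE pmulr_rgt0 //.
have y0 : x *m B != 0.
  by apply: contra x0 => /eqP/(congr1 (mulmx^~ (invmx B))); rewrite mulmxK // mul0mx => ->.
have [j yj] : exists j, (x *m B) 0 j != 0.
  apply: contrapT => /forallNP E; case/eqP: y0; apply/rowP => j; rewrite [RHS]mxE.
  by apply/eqP/negPn/negP; exact: E.
rewrite mxE (bigD1 j) //= ltr_pwDl //.
  by rewrite [_^T _ _]mxE -expr2 lt_neqAle sqr_ge0 eq_sym sqrf_eq0 yj.
by apply: sumr_ge0 => i _; rewrite [_^T _ _]mxE -expr2 sqr_ge0.
Qed.

End QuaternionForms.

Section ClosedForms.
Context {R : realType}.

Lemma closed_form_exact n (U : set 'rV[R]_n) (W : 'rV[R]_n -> 'M[R]_n)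
    (theta : 'I_n -> 'rV[R]_n -> R) : open U ->
  (forall j, smooth_on U (theta j)) ->
  (forall u, U u -> forall j l, W u j l =
     'D_(delta_mx 0 l) (theta j) u - 'D_(delta_mx 0 j) (theta l) u) ->
  smooth_on U W /\ closed_form U W.
Proof.
move=> oU sth WE; have sD j l : smooth_on U (fun u => 'D_(delta_mx 0 l) (theta j) u).
  exact: smooth_derive (sth j).
split.
  apply: smooth_mx => // j l; apply: (smooth_eq oU _ (smoothB oU (sD j l) (sD l j))).
  by move=> u Uu; rewrite WE.
move=> u Uu.
have dE i j l : 'D_(delta_mx 0 i) (fun z => W z j l) u =
    'D_(delta_mx 0 i) (fun z => 'D_(delta_mx 0 l) (theta j) z) u -
    'D_(delta_mx 0 i) (fun z => 'D_(delta_mx 0 j) (theta l) z) u.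
  rewrite -deriveB; [|exact: smooth_derivable (sD j l) Uu|exact: smooth_derivable (sD l
    j) Uu].
  apply: near_eq_derive; apply: filterS (open_nbhs_nbhs (conj oU Uu)) => z Uz.
  exact: WE.
(* The six second derivatives of [theta] in the cyclic sum cancel in pairs by [derive_commute]. *)
have cyc (a a' b b' c c' : R) : a = a' -> b = b' -> c = c' ->
    (a - b) + (b' - c) + (c' - a') = 0 by move=> -> -> ->; ring.
move=> i j l; rewrite /= !dE.
exact: (cyc _ _ _ _ _ _ (derive_commute _ _ oU (sth j) Uu)
  (derive_commute _ _ oU (sth l) Uu) (derive_commute _ _ oU (sth i) Uu)).
Qed.

End ClosedForms.

(** * The symplectic forms in a chart *)

Section ChartForms.
Context {R : realType} (G : 'M[R]_3) (e : bool) (J : set R) (C : R -> 'M[R]_3).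
Context (oJ : open J) (sC : smooth_on J C)
  (CE : forall t, J t -> (C t)^T *m C t = G + t%:M /\ 0 < (-1) ^+ e * \det (C t)).
Implicit Types (u v w : 'rV[R]_4) (x z : 'rV[R]_3).

Let C' t := 'D_1 C t.
Let kappa t := (1 / 2) *: axial ((C t)^T *m C' t).

Lemma is_derive_rot u v : is_derive u v (@rot_part R) (rot_part v).
Proof.
apply: is_derive_mx => i j.
have E k : is_derive u v (fun z : 'rV[R]_4 => z 0 k) (v 0 k).
  by apply: is_derive_entry; exact: is_derive_id.
have jE (w : 'rV[R]_4) : rot_part w i j = w 0 (inord j).
  by rewrite mxE; elim/ord3P: j => /=; congr (w _ _); apply/val_inj; rewrite /= inordK.
by under eq_fun do rewrite jE; rewrite jE.
Qed.

Lemma is_derive_height u v : is_derive u v (@height R) (height v).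
Proof. by apply: is_derive_entry; exact: is_derive_id. Qed.

Lemma is_derive_C_height u v : chart_dom J u ->
  is_derive u v (fun u => C (height u)) (height v *: C' (height u)).
Proof.
move=> Uu; apply: is_derive_mx => i j.
have sij := smooth_entry i j oJ sC.
have dh := @differentiable_coord R 1 4 u 0 3 : differentiable (@height R) u.
have dC := smooth_differentiable sij Uu.
apply: DeriveDef.
  by apply: diff_derivable;
    exact: (@differentiable_comp _ _ _ _ (@height R) (fun t => C t i j)).
rewrite [LHS](derive_comp1 _ dh dC) mxE mulrC.
have [_ ->] := is_derive_height u v.
by rewrite /C' derive_mx ?mxE //; exact: smooth_derivable sC Uu.
Qed.

Lemma is_derive_chart k u v : chart_dom J u ->
  is_derive u v (chart C k) (flip k *m cay (rot_part u) *m
    (hat (omega (rot_part u) (rot_part v)) *m C (height u) + height v *: C' (height u))).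
Proof.
move=> Uu; have dR := is_derive_cay (is_derive_rot u v).
have dF := is_derive_cst (flip k : 'M[R]_3) u v.
apply: is_derive_eq (is_derive_mulmx (is_derive_mulmx dF dR) (is_derive_C_height v Uu)) _.
by rewrite mul0mx add0r mulmxDr !mulmxA.
Qed.

Lemma C_derive t : J t -> (C t)^T *m C' t = (1 / 2)%:M + hat (kappa t).
Proof.
move=> Jt; apply: scalar_hat_decomp.
have := derive_gram oJ sC (smooth_id J) Jt (fun a Ja => (CE Ja).1).
by rewrite derive_id.
Qed.

(** The skew coordinate of a tangent vector: the first term is the angular velocity transported by
    [C] as in [hat_conj], the second comes from the motion of [C] itself. *)
Definition zeta u v : 'rV[R]_3 :=
  \det (C (height u)) *: (omega (rot_part u) (rot_part v) *m (invmx (C (height u)))^T) +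
  height v *: kappa (height u).

Lemma chart_tangent k u v : chart_dom J u ->
  (chart C k u)^T *m 'D_v (chart C k) u = (height v / 2)%:M + hat (zeta u v).
Proof.
move=> Uu; have [_ ->] := is_derive_chart k v Uu.
have C0 := det_C_neq0 CE Uu; have Cu := C_unit CE Uu.
rewrite mulmxA /chart trmx_mul -[_ *m _ *m (_ *m cay _)]mulmxA rotation_trans mulmx1.
rewrite mulmxDr mulmxA -scalemxAr C_derive // /zeta hatD [hat (height v *: _)]hatZ
  scalerDr addrCA.
congr (_ + (_ + _)).
  by rewrite scale_scalar_mx; congr _%:M; rewrite mul1r.
apply: hat_conj => //.
by rewrite -scalemxAl -mulmxA -trmx_mul mulmxV // trmx1 mulmx1.
Qed.

Lemma zeta_eq0 u v : chart_dom J u -> height v = 0 -> zeta u v = 0 -> v = 0.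
Proof.
move=> Uu v3; have C0 := det_C_neq0 CE Uu; have Cu := C_unit CE Uu.
rewrite /zeta v3 scale0r addr0 => /eqP; rewrite scaler_eq0 (negbTE C0) /= => /eqP.
move=> /(congr1 (mulmx^~ (C (height u))^T)).
rewrite -mulmxA -trmx_mul mulmxV // trmx1 mulmx1 mul0mx => /omega_eq0 x0.
rewrite -[v]chart_pointK x0 v3; apply/rowP => j; rewrite !mxE /=.
by elim/ord4P: j => /=; rewrite ?mxE.
Qed.

Lemma coord_linear u : linear (fun v => chart_point (zeta u v) (height v / 2)).
Proof.
move=> a v w.
have rD : rot_part (a *: v + w) = a *: rot_part v + rot_part w by mx3.
have hD : height (a *: v + w) = a * height v + height w by rewrite /height !mxE.
have zD : zeta u (a *: v + w) = a *: zeta u v + zeta u w.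
  rewrite /zeta rD hD omegaD omegaZ mulmxDl -scalemxAl;
    move: (omega _ _ *m _) (omega _ _ *m _) (kappa _) => p q k.
  by apply/rowP => i; rewrite !mxE; ring.
rewrite zD hD; move: (zeta u v) (zeta u w) => p q.
by apply/rowP; elim/ord4P; rewrite !mxE /= ?mxE; ring.
Qed.

Definition frame_mx u : 'M[R]_4 :=
  \matrix_j chart_point (zeta u (delta_mx 0 j)) (height (delta_mx 0 j) / 2).

Lemma mul_frame_mx u v : v *m frame_mx u = chart_point (zeta u v) (height v / 2).
Proof.
pose fL := GRing.isLinear.Build R 'rV[R]_4 'rV[R]_4 *:%R _ (coord_linear u).
pose f : {linear 'rV[R]_4 -> 'rV[R]_4} := HB.pack (fun v => chart_point (zeta u v)
  (height v / 2)) fL.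
rewrite -[RHS]/(f v) [in RHS](row_sum_delta v) linear_sum mulmx_sum_row.
by apply: eq_bigr => j _; rewrite linearZ rowK.
Qed.

Lemma frame_mx_unit u : chart_dom J u -> frame_mx u \in unitmx.
Proof.
move=> Uu; rewrite -row_free_unit -kermx_eq0; apply/eqP/row_matrixP => i.
rewrite row0; set v := row i _.
have vM : v *m frame_mx u = 0 by rewrite -row_mul mulmx_ker row0.
rewrite mul_frame_mx in vM.
have v3 : height v = 0.
  have h0 : height 0 = 0 :> R by rewrite /height mxE.
  have := congr1 (@height R) vM; rewrite height_chart_point h0 => /eqP.
  by rewrite mulf_eq0 invr_eq0 pnatr_eq0 orbF => /eqP.
apply: zeta_eq0 Uu v3 _.
by have := congr1 (@rot_part R) vM; rewrite rot_chart_point => ->; apply: row3P;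
  rewrite !mxE.
Qed.

Section FrameForm.
Context (lam mu : R) (lam0 : 0 < lam) (mu0 : 0 < mu) (s : bool).
Context (F : 'I_3 -> 'rV[R]_3) (FP : frame mu s F).

Lemma leaf_form_chart k u v w : chart_dom J u ->
  leaf_form lam mu F (chart C k u) ('D_v (chart C k) u) ('D_w (chart C k) u) =
  4 * mu / \det (C (height u)) *
    dot (F 0) (cross (zeta u v) (zeta u w) + (height w / 2) *: zeta u v - (height v /
      2) *: zeta u w).
Proof.
move=> Uu; have p0 := det_chart_neq0 CE k Uu.
by rewrite (leaf_formE lam0 mu0 FP p0 (chart_tangent k v Uu) (chart_tangent k w Uu))
  det_chart.
Qed.

Lemma leaf_form_mxE k u : chart_dom J u ->
  leaf_form_mx lam mu F (chart C k) u = (4 * mu / \det (C (height u))) *: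
    (frame_mx u *m quat_form (F 0) *m (frame_mx u)^T).
Proof.
move=> Uu; apply/matrixP => j l; rewrite mxE leaf_form_chart // [RHS]mxE; congr (_ * _).
rewrite -quat_formE -!mul_frame_mx.
have E (X : 'M[R]_4) : (delta_mx (0 : 'I_1) j *m X *m (delta_mx (0 : 'I_1) l)^T) 0 0 =
  X j l.
  by rewrite trmx_delta -colE -rowE mxE mxE.
by rewrite -E trmx_mul !mulmxA.
Qed.

Let theta (j : 'I_4) u : R :=
  4 * mu * dot (F 0) (omega (rot_part u) (rot_part (delta_mx 0 j)) *m C (height u)).

Lemma smooth_theta j : smooth_on (chart_dom J) (theta j).
Proof.
have oU := chart_dom_open oJ.
have sx := smooth_rot oU.
have sj i := smooth_entry 0 i oU sx.
have sc k := @smooth_cst R _ R (chart_dom J) k.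
rewrite /theta; move: (rot_part (delta_mx 0 j)) => d.
have scr i : smooth_on (chart_dom J) (fun u => cross (rot_part u) d 0 i).
  apply: (@smooth_eq _ _ _ _ (fun u => [:: rot_part u 0 1 * d 0 2 - rot_part u 0 2 * d 0 1;
    rot_part u 0 2 * d 0 0 - rot_part u 0 0 * d 0 2;
      rot_part u 0 0 * d 0 1 - rot_part u 0 1 * d 0 0]`_i)) => //.
    by move=> u _; rewrite [RHS]mxE.
  by elim/ord3P: i => /=; apply: (smoothB oU); apply: (smoothM oU).
have so : smooth_on (chart_dom J) (fun u => omega (rot_part u) d).
  apply: smooth_mx => // i l; rewrite [i]ord1.
  apply: (@smooth_eq _ _ _ _ (fun u => 2 * (1 + dot (rot_part u) (rot_part u))^-1 *
    (d 0 l - cross (rot_part u) d 0 l))) => //.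
    by move=> u _; rewrite /omega [RHS]mxE [X in _ = _ * X]mxE [X in _ = _ * (_ + X)]mxE.
  apply: (smoothM oU); last exact: smoothB oU (sc _) (scr l).
  apply: (smoothM oU) => //.
  exact: smoothV oU (fun u _ => nsq_neq0 (rot_part u)) (smoothD oU (sc 1) (smooth_dotxx
    oU sx)).
have sm := smooth_mulmx oU so (smooth_C oJ sC oU (@subset_refl _ _)).
rewrite /dot; apply: (smoothM oU) => //.
by apply: (smoothD oU); [apply: (smoothD oU)|]; apply: (smoothM oU) => //;
  exact: (smooth_entry 0 _ oU sm).
Qed.

Let dom u v d : 'rV[R]_3 :=
  (- (4 * dot (rot_part u) (rot_part v) / (1 + dot (rot_part u) (rot_part u)) ^+ 2)) *:
     (d - cross (rot_part u) d) -
  (2 / (1 + dot (rot_part u) (rot_part u))) *: cross (rot_part v) d.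

Lemma derive_theta j u v : chart_dom J u -> 'D_v (theta j) u = 4 * mu *
  dot (F 0) (dom u v (rot_part (delta_mx 0 j)) *m C (height u) +
     omega (rot_part u) (rot_part (delta_mx 0 j)) *m (height v *: C' (height u))).
Proof.
move=> Uu; have dm := is_derive_mulmx (is_derive_omega (rot_part (delta_mx 0 j))
  (is_derive_rot u v)) (is_derive_C_height v Uu).
have dj l := is_derive_entry 0 l dm.
have c k := is_derive_cst_fun u v k.
have cj l := is_deriveM_fun (c (F 0 0 l)) (dj l).
have [_ E] := is_deriveM_fun (c (4 * mu)) (is_deriveD_fun (is_deriveD_fun (cj 0) (cj
  1)) (cj 2)).
rewrite [LHS]E mul0r add0r; congr (_ * _).
by rewrite !mul0r !add0r.
Qed.

(* In the chart, [omega_i] is exact: it is minus the differential of the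
   pairing of [F i] with the left-invariant form [omega] transported by [C]. *)
Lemma leaf_form_theta k u j l : chart_dom J u ->
  leaf_form_mx lam mu F (chart C k) u j l =
  'D_(delta_mx 0 l) (theta j) u - 'D_(delta_mx 0 j) (theta l) u.
Proof.
move=> Uu; rewrite mxE leaf_form_chart // !derive_theta //.
have C0 := det_C_neq0 CE Uu; have Cu := C_unit CE Uu.
have := C_derive Uu; move: (delta_mx 0 j) (delta_mx 0 l) => v w CC'.
rewrite -mulrBr -mulrA; congr (_ * _).
have dotB (x y z : 'rV[R]_3) : dot x y - dot x z = dot x (y - z).
  by rewrite /dot !mxE; ring.
rewrite dotB -dotZr; congr dot.
set x := rot_part u; set D := C (height u) in C0 Cu CC' *; set D' := C' (height u) in CC' *.
set a := omega x (rot_part v); set b := omega x (rot_part w).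
set ka := kappa (height u) in CC'.
(* The rotational parts of [zeta]. Both sides are compared after multiplication by [\det D], which
   turns every inverse of [D] into cofactors. *)
pose za := \det D *: (a *m (invmx D)^T); pose zb := \det D *: (b *m (invmx D)^T).
have zaD : za *m D^T = \det D *: a by rewrite -scalemxAl -mulmxA -trmx_mul mulmxV //
  trmx1 mulmx1.
have zbD : zb *m D^T = \det D *: b by rewrite -scalemxAl -mulmxA -trmx_mul mulmxV //
  trmx1 mulmx1.
have D'E y zy : zy *m D^T = \det D *: y -> \det D *: (y *m D') = (1 / 2) *: zy + cross
  zy ka.
  move=> yE; rewrite scalemxAl -yE -mulmxA CC' mulmxDr mul_mx_scalar; congr (_ + _).
  exact: row_mul_hat.
have crossE : cross za zb = \det D *: (cross a b *m D).
  apply: (scalerI C0); rewrite -mul_cross zaD zbD crossZl crossZr -scalemxAl scalerA.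
  by rewrite -scalemxAl scalerA.
have MC := maurer_cartan x (rot_part w) (rot_part v); rewrite /= -/a -/b in MC.
have -> : dom u w (rot_part v) *m D + a *m (height w *: D') -
    (dom u v (rot_part w) *m D + b *m (height v *: D')) =
    cross a b *m D + height w *: (a *m D') - height v *: (b *m D').
  rewrite opprD addrACA -mulmxBl /dom -/x MC -crossC -!scalemxAr.
  by rewrite addrA.
have RE : \det D *: (cross a b *m D + height w *: (a *m D') - height v *: (b *m D')) =
    cross za zb + height w *: ((1 / 2) *: za + cross za ka) - height v *: ((1 / 2) *:
      zb + cross zb ka).
  have lin (c p q : R) (y1 y2 y3 : 'rV[R]_3) :
      c *: (y1 + p *: y2 - q *: y3) = c *: y1 + p *: (c *: y2) - q *: (c *: y3).
    by apply/rowP => i; rewrite !mxE; ring.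
  by rewrite lin -crossE (D'E a za zaD) (D'E b zb zbD).
apply: (scalerI C0); rewrite scalerA mulfV // scale1r RE.
rewrite /zeta -/D -/ka -/x -/a -/b -/za -/zb.
(* The terms quadratic in the heights cancel, so that [kappa] enters linearly. *)
have expand (p q k0 : 'rV[R]_3) (hv hw : R) :
    cross (p + hv *: k0) (q + hw *: k0) + (hw / 2) *: (p + hv *: k0) - (hv / 2) *: (q +
      hw *: k0) =
    cross p q + hw *: ((1 / 2) *: p + cross p k0) - hv *: ((1 / 2) *: q + cross q k0).
  by mx3; field.
exact: expand.
Qed.

Lemma leaf_form_closed k :
  smooth_on (chart_dom J) (leaf_form_mx lam mu F (chart C k)) /\
  closed_form (chart_dom J) (leaf_form_mx lam mu F (chart C k)).
Proof.
apply: closed_form_exact (chart_dom_open oJ) smooth_theta _.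
by move=> u Uu j l; exact: leaf_form_theta.
Qed.

End FrameForm.

End ChartForms.

(** * Hamiltonian curves and leaves *)

Section SmoothDet.
Context {R : realType}.

Lemma smooth_det (V : normedModType R) (U : set V) (A : V -> 'M[R]_3) : open U ->
  smooth_on U A -> smooth_on U (fun z => \det (A z)).
Proof.
move=> oU sA; have s i j := smooth_entry i j oU sA; under eq_fun do rewrite det3.
have m (f g : V -> R) := @smoothM R V U f g oU.
have b i j k l i' j' k' l' := smoothB oU (m _ _ (s i j) (s k l)) (m _ _ (s i' j') (s k'
  l')).
apply: (smoothD oU); last exact: m (s _ _) (b _ _ _ _ _ _ _ _).
by apply: (smoothB oU); exact: m (s _ _) (b _ _ _ _ _ _ _ _).
Qed.

Lemma smooth_matrix_id m n (U : set 'M[R]_(m, n)) : open U -> smooth_on U (fun q => q).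
Proof. by move=> oU; apply: smooth_mx => // i j; exact: smooth_coord. Qed.

Lemma smooth_affine (V : normedModType R) (U : set R) (y d : V) : open U ->
  smooth_on U (fun a : R => y + a *: d).
Proof.
move=> oU; apply: smoothD => //; first exact: smooth_cst.
by move=> k; apply: Ck_scalel => //; exact: smooth_id.
Qed.

Lemma open_det_neq0 : open [set q : 'M[R]_3 | \det q != 0].
Proof.
have oN : open [set x : R | x != 0] by exact: open_neq.
have := open_setI_preimage openT (smooth_det openT (smooth_matrix_id openT)) oN.
by rewrite (_ : [set x | _] = [set q : 'M[R]_3 | \det q != 0]) //;
  apply/seteqP; split => [q [_ q0]|q q0]; [exact: q0|split].
Qed.

End SmoothDet.

Section Arcs.
Context {R : realType} (lam mu : R) (lam0 : 0 < lam) (mu0 : 0 < mu) (s : bool).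
Context (F : 'I_3 -> 'rV[R]_3) (FP : frame mu s F).

Lemma piF_self p al : \det p != 0 -> piF lam mu F p al al = 0.
Proof.
by move=> p0; have := piF_antisym lam0 mu0 FP al al p0; move: (piF _ _ _ _ _ _) => x; lra.
Qed.

(* A curve in a leaf is a Hamiltonian trajectory once its parameter extends to a
   function [T] near it: if [al t] is a covector with [pi^# (al t) = gam' t],
   then [h q = <al (T q), q - gam (T q)>] has differential [al t] at [gam t],
   because [<al t, gam' t> = pi (al t, al t) = 0]. *)
Lemma ham_arc_curve (K : set R) (O : set 'M[R]_3) (gam : R -> 'M[R]_3)
    (T : 'M[R]_3 -> R) (G : 'M[R]_3) (m : R -> R) :
  open K -> smooth_on K gam -> smooth_on K m ->
  (forall t, K t -> \det (gam t) != 0) ->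
  (forall a, K a -> (gam a)^T *m gam a = G + (m a)%:M) ->
  open O -> smooth_on O T -> (forall q, O q -> K (T q)) ->
  (forall q, O q -> \det q != 0) ->
  (forall t, 0 <= t <= 1 -> O (gam t) /\ T (gam t) = t) ->
  ham_arc lam mu F (gam 0) (gam 1).
Proof.
move=> oK sg sm g0 gE oO sT OK O0 gT.
pose N t := (gam t)^T *m 'D_1 gam t.
have sdg : smooth_on K (fun t => 'D_1 gam t) by exact: smooth_derive.
have sgT : smooth_on K (fun t => (gam t)^T).
  apply: smooth_mx => // i j; under eq_fun do rewrite mxE; exact: smooth_entry.
have sN : smooth_on K N by exact: smooth_mulmx.
pose al t := flat mu F (gam t) (N t 0 0) ((1 / 2) *: axial (N t)).
have NE t : K t -> N t = (N t 0 0)%:M + hat ((1 / 2) *: axial (N t)).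
  move=> Kt; have := scalar_hat_decomp (derive_gram oK sg sm Kt gE); rewrite -/(N t).
  set z := _ *: axial _; move=> NE; rewrite {1}NE; congr (_%:M + _).
  by rewrite NE !mxE /= mulr1n addr0.
have alS t : K t -> piF_sharp lam mu F (gam t) (al t) = 'D_1 gam t.
  by move=> Kt; apply: (piF_sharp_flat lam0 mu0 FP (g0 t Kt)); exact: NE.
have sal : smooth_on K al.
  have c k := @smooth_cst R R R K k.
  apply: (smooth_mulmx oK) => //; apply: smooth_mx => // i j.
  apply: (@smooth_eq _ _ _ _ (fun t => - (2 * (8 * mu)^-1 * \det (gam t))^-1 *
    ((1 / 2 * axial (N t) 0 i) * F 0 0 j - (N t 0 0 / 2) * hat (F 0) i j))) => //.
    move=> t _; rewrite [RHS]mxE [X in _ = _ * X]mxE [X in _ = _ * (_ + X)]mxE.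
    by rewrite [X in _ = _ * (_ - X)]mxE [X in _ = _ * (X - _)]mxE big_ord1 [X in _ = _
      * (X * _ - _)]mxE [X in _ = _ * (X * _ - _)]mxE.
  apply: (smoothM oK).
    apply: (smoothN oK); apply: (smoothV oK) => [t Kt|].
      by rewrite !mulf_neq0 ?g0 // invr_neq0 // mulf_neq0 ?gt_eqF.
    by apply: (smoothM oK) => //; exact: smooth_det.
  apply: (smoothB oK); apply: (smoothM oK) => //.
    by apply: (smoothM oK) => //; exact: (smooth_entry 0 i oK (smooth_axial oK sN)).
  by apply: (smoothM oK) => //; exact: smooth_entry.
pose h q := \sum_k \sum_l al (T q) k l * (q k l - gam (T q) k l).
have scT (f : R -> 'M[R]_3) k l : smooth_on K f -> smooth_on O (fun q => f (T q) k l).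
  move=> sf; apply: (@smooth_comp _ _ K O (fun t => f t k l) T) => //.
  exact: smooth_entry.
have sh : smooth_on O h.
  apply: (smooth_sum _ oO) => k; apply: (smooth_sum _ oO) => l.
  by apply: (smoothM oO); [exact: scT|apply: (smoothB oO);
    [exact: smooth_coord|exact: scT]].
have hE t v : 0 <= t <= 1 -> is_derive (gam t) v h (pairing (al t) v).
  move=> t01; have [Og Tg] := gT t t01; have Kt : K t by rewrite -Tg; exact: OK.
  have dT : is_derive (gam t) v T ('D_v T (gam t)) by exact: smooth_is_derive sT Og.
  set c := 'D_v T (gam t) in dT.
  have al0 : pairing (al t) ('D_1 gam t) = 0.
    by rewrite -(alS t Kt) -(piF_pairing lam0 mu0) piF_self // g0.
  have dgT k l : is_derive (gam t) v (fun q => gam (T q) k l) ('D_1 gam t k l * c).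
    apply: DeriveDef; first exact: smooth_derivable (scT gam k l sg) Og.
    rewrite [LHS](@derive_comp1 _ _ (fun a => gam a k l) T).
    - by rewrite Tg derive_mx ?mxE //; apply: smooth_derivable sg Kt.
    - exact: smooth_differentiable sT Og.
    - by rewrite Tg; exact: smooth_differentiable (smooth_entry k l oK sg) Kt.
  have dkl k l : is_derive (gam t) v (fun q => al (T q) k l * (q k l - gam (T q) k l))
      (al t k l * (v k l - 'D_1 gam t k l * c)).
    have da : is_derive (gam t) v (fun q => al (T q) k l) ('D_v (fun q => al (T q) k l)
      (gam t)).
      exact: smooth_is_derive (scT al k l sal) Og.
    have dq := is_derive_entry k l (is_derive_id (gam t) v).
    (* The derivative of [al (T q)] is multiplied by [q - gam (T q)], which vanishes at
       [q = gam t]. *)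
    apply: is_derive_eq (is_deriveM_fun da (is_deriveD_fun dq (is_deriveN_fun (dgT k
      l)))) _.
    by rewrite Tg subrr mulr0 add0r.
  have := is_derive_sum3 (fun k => is_derive_sum3 (dkl k)).
  move=> dh; apply: is_derive_eq dh _.
  transitivity (pairing (al t) v - pairing (al t) ('D_1 gam t) * c);
    last by rewrite al0 mul0r subr0.
  rewrite /pairing mulr_suml -sumrB; apply: eq_bigr => k _.
  by rewrite mulr_suml -sumrB; apply: eq_bigr => l _; rewrite mulrBr mulrA.
exists O, h, gam; split => //.
  by move=> q /O0 q0; rewrite (MoE lam0 mu0 FP).
move=> t t01; have [Og Tg] := gT t t01; have Kt : K t by rewrite -Tg; exact: OK.
split=> //.
have -> : grad h (gam t) = al t.
  apply/matrixP => k l; rewrite mxE; have [_ ->] := hE t (delta_mx k l) t01.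
  rewrite /pairing (bigD1 k) //= [X in _ + X]big1 ?addr0 => [|k' /negbTE kk]; last first.
    by apply: big1 => l' _; rewrite [delta_mx _ _ _ _]mxE kk mulr0.
  rewrite (bigD1 l) //= big1 ?addr0 => [|l' /negbTE ll].
    by rewrite [delta_mx _ _ _ _]mxE !eqxx mulr1.
  by rewrite [delta_mx _ _ _ _]mxE ll andbF mulr0.
by rewrite alS //; exact: smooth_is_derive sg Kt.
Qed.

(** The derivative of the Gram matrix along the arc is scalar because the velocity is tangent, and
    the determinant keeps its sign because it never vanishes. *)
Lemma ham_arc_gram p q (e : bool) : ham_arc lam mu F p q -> 0 < (-1) ^+ e * \det p ->
  0 < (-1) ^+ e * \det q /\ exists c, q^T *m q = p^T *m p + c%:M.
Proof.
move=> [U [h [gam [oU UM sh [<- <-] gd]]]] dp.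
have g0 (t : R) : 0 <= t <= 1 -> \det (gam t) != 0.
  by move=> /gd[/UM]; rewrite (MoE lam0 mu0 FP).
pose v t := piF_sharp lam mu F (gam t) (grad h (gam t)).
have dg (t : R) : 0 <= t <= 1 -> is_derive t 1 gam (v t) by move=> /gd[].
pose D t := (v t)^T *m gam t + (gam t)^T *m v t.
have dG (t : R) i j : 0 <= t <= 1 -> is_derive t 1 (fun a => ((gam a)^T *m gam a) i j)
  (D t i j).
  move=> t01; apply: is_derive_entry; apply: is_derive_mulmx; last exact: dg.
  apply: is_derive_mx => k l; rewrite mxE; under eq_fun do rewrite mxE.
  exact: is_derive_entry (dg t t01).
have DE (t : R) i j : 0 <= t <= 1 -> D t i j = (i == j)%:R * D t 0 0.
  move=> t01; have [c [z N]] := tangent_piF_sharp lam0 mu0 FP (grad h (gam t)) (g0 t t01).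
  have -> : D t = (2 * c)%:M.
    rewrite /D -{1}[gam t]trmxK -trmx_mul -/(v t) N.
    by mx3; rewrite ?mulr1n ?mulr0n; ring.
  by rewrite !mxE eqxx mulr1n; case: (i == j); rewrite ?mul1r ?mul0r.
split; last first.
  exists (((gam 1)^T *m gam 1) 0 0 - ((gam 0)^T *m gam 0) 0 0).
  apply/matrixP => i j; rewrite [RHS]mxE [_%:M _ _]mxE.
  (* Subtracting the corner entry on the diagonal leaves a function with zero derivative. *)
  have [t t01] := @MVT_is_derive R
    (fun a => ((gam a)^T *m gam a) i j - (i == j)%:R * ((gam a)^T *m gam a) 0 0)
    (fun t => D t i j - (0 * ((gam t)^T *m gam t) 0 0 + (i == j)%:R * D t 0 0)) 1 ltr01
    (fun t t01 => is_deriveD_fun (dG t i j t01)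
      (is_deriveN_fun (is_deriveM_fun (is_derive_cst_fun t 1 (i == j)%:R) (dG t 0 0 t01)))).
  rewrite DE // mul0r add0r subrr mul0r; case: (i == j);
    rewrite ?mul1r ?mul0r ?mulr1n ?mulr0n.
    by move=> /eqP; rewrite subr_eq0 => /eqP/(canRL (subrK _)) ->;
      rewrite -addrA [- _ + _]addrC.
  by rewrite !subr0 addr0 => /eqP; rewrite subr_eq0 => /eqP.
have e0 (t : R) : 0 <= t <= 1 -> (-1) ^+ e * \det (gam t) != 0.
  by move=> t01; rewrite mulf_neq0 ?signr_eq0 // g0.
rewrite ltNge; apply/negP => dq.
have cont : {within `[0, 1], continuous (fun t => (-1) ^+ e * \det (gam t))}.
  apply: continuous_in_subspaceT => t; rewrite inE /= in_itv /= => t01.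
  have [dgt _] := dg t t01.
  have cg : {for t, continuous gam} by exact/differentiable_continuous/derivable1_diffP.
  have sd := @smoothM R _ setT (fun=> (-1) ^+ e) (fun q : 'M[R]_3 => \det q) openT
    (smooth_cst _ _) (smooth_det openT (smooth_matrix_id openT)) 0%N (gam t) Logic.I.
  exact: (@continuous_comp _ _ _ gam (fun q => (-1) ^+ e * \det q) t cg sd).
have [|t t01 E] := IVT (v := 0) ler01 cont.
  by rewrite ge_min le_max dq (ltW dp) orbT.
by move: t01; rewrite in_itv /= => /e0; rewrite E eqxx.
Qed.

End Arcs.

Section LeafConnected.
Context {R : realType} (G : 'M[R]_3) (e : bool) (J : set R) (C : R -> 'M[R]_3).
Context (oJ : open J) (Jup : forall t t', J t -> t <= t' -> J t') (sC : smooth_on J C)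
  (CE : forall t, J t -> (C t)^T *m C t = G + t%:M /\ 0 < (-1) ^+ e * \det (C t))
  (Jmem : forall q t, \det q != 0 -> q^T *m q = G + t%:M -> J t).
Context (lam mu : R) (lam0 : 0 < lam) (mu0 : 0 < mu) (s : bool).
Context (F : 'I_3 -> 'rV[R]_3) (FP : frame mu s F).

Let reach := clos_refl_trans 'M[R]_3 (ham_arc lam mu F).

(** The arc is a straight segment in Cayley coordinates; its time is recovered by projecting
    [cay_inv] onto the direction of the segment. *)
Lemma rotation_arc k (x y : 'rV[R]_3) t : J t ->
  reach (chart C k (chart_point x t)) (chart C k (chart_point y t)).
Proof.
move=> Jt; have [->|xy] := eqVneq x y; first exact: rt_refl.
pose d := y - x; have d0 : dot d d != 0.
  apply: contra xy => /eqP; rewrite /dot -!expr2 => /eqP.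
  rewrite !paddr_eq0 ?addr_ge0 ?sqr_ge0 // !sqrf_eq0 => /andP[/andP[/eqP d0 /eqP d1]
    /eqP d2].
  have : d = 0 by apply: row3P; rewrite ?d0 ?d1 ?d2 [RHS]mxE.
  by move/eqP; rewrite subr_eq0 eq_sym.
pose gam a := flip k *m cay (x + a *: d) *m C t.
have -> : chart C k (chart_point x t) = gam 0.
  by rewrite /chart rot_chart_point height_chart_point /gam scale0r addr0.
have -> : chart C k (chart_point y t) = gam 1.
  by rewrite /chart rot_chart_point height_chart_point /gam scale1r /d addrC subrK.
have Cu := C_unit CE Jt; have [CCE _] := CE Jt.
pose Q q := flip k *m (q *m invmx (C t)).
have oD := @open_det_neq0 R.
have oT : open (setT : set R) by exact: openT.
have sQ (U : set 'M[R]_3) : open U -> smooth_on U Q.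
  move=> oU; apply: (smooth_mulmx oU); first exact: smooth_cst.
  by apply: (smooth_mulmx oU); [exact: smooth_matrix_id|exact: smooth_cst].
pose O := [set q | [set q : 'M[R]_3 | \det q != 0] q /\ 1 + \tr (Q q) != 0].
have oO : open O.
  have oN : open [set x : R | x != 0] by exact: open_neq.
  exact: open_setI_preimage oD (smooth_trace oD (sQ _ oD)) oN.
have detg a : \det (gam a) != 0.
  by rewrite /gam !det_mulmx det_flip det_cay !mul1r (det_C_neq0 CE Jt).
have QK a : Q (gam a) = cay (x + a *: d).
  by rewrite /Q /gam mulmxK // mulmxA flipK mul1mx.
apply: rt_step; apply: (@ham_arc_curve _ lam mu lam0 mu0 s F FP setT O gam
  (fun q => (dot d d)^-1 * dot (cay_inv (Q q) - x) d) G (fun=> t)) => //.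
- apply: (smooth_mulmx oT); last exact: smooth_cst.
  apply: (smooth_mulmx oT); first exact: smooth_cst.
  by apply: (smooth_cay oT); exact: smooth_affine.
- exact: smooth_cst.
- move=> a _; rewrite /gam trmx_mul mulmxA -[_ *m (flip k *m _)^T *m _]mulmxA.
  by rewrite rotation_trans mulmx1.
- have sc : smooth_on O (fun q => cay_inv (Q q) - x).
    apply: (smoothD oO); last exact: smooth_cst.
    by apply: (smooth_cay_inv oO) => [q []//|]; exact: sQ.
  have c k0 := @smooth_cst R _ R O k0.
  have sj j := smoothM oO (smooth_entry 0 j oO sc) (c (d 0 j)).
  apply: (smoothM oO) => //; rewrite /dot.
  by apply: (smoothD oO); [apply: (smoothD oO)|]; exact: sj.
- by move=> q [].
- move=> a _; split; first by split;
  [exact: detg|rewrite QK trace_cay mulf_neq0 ?invr_neq0 ?nsq_neq0].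
  by rewrite QK cayK addrAC subrr add0r dotZl mulrCA mulVf // mulr1.
Qed.

(** Time is recovered from the corner entry of the Gram matrix, which is affine in the height. *)
Lemma height_arc (Q : 'M[R]_3) t t' : Q^T *m Q = 1%:M -> J t -> J t' ->
  reach (Q *m C t) (Q *m C t').
Proof.
move=> QQ Jt Jt'; have [->|tt] := eqVneq t t'; first exact: rt_refl.
pose d := t' - t; have d0 : d != 0 by rewrite subr_eq0 eq_sym.
pose gam a := Q *m C (t + a * d).
have -> : Q *m C t = gam 0 by rewrite /gam mul0r addr0.
have -> : Q *m C t' = gam 1 by rewrite /gam mul1r /d addrC subrK.
have Q0 : \det Q != 0.
  have : \det Q * \det Q = 1 by rewrite -{1}det_tr -det_mulmx QQ det1.
  by apply: contra_eq_neq => ->; rewrite mulr0 eq_sym oner_neq0.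
pose m a := t + a * d.
have oT : open (setT : set R) by exact: openT.
have sm (U : set R) : open U -> smooth_on U m.
  move=> oU; apply: (smoothD oU); first exact: smooth_cst.
  by apply: (smoothM oU); [exact: smooth_id|exact: smooth_cst].
pose K := [set a | J (m a)].
have oK : open K.
  have := open_setI_preimage oT (sm _ oT) oJ.
  by rewrite (_ : [set x | _] = K) //; apply/seteqP; split => [a [_ Ja]|a Ja];
    [exact: Ja|split].
pose T (q : 'M[R]_3) := ((q^T *m q) 0 0 - G 0 0 - t) / d.
have sT (U : set 'M[R]_3) : open U -> smooth_on U T.
  move=> oU; apply: (smoothM oU); last exact: smooth_cst.
  apply: (smoothB oU); last exact: smooth_cst.
  apply: (smoothB oU); last exact: smooth_cst.
  apply: (smooth_entry 0 0 oU); apply: (smooth_mulmx oU); last exact: smooth_matrix_id.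
  by apply: smooth_mx => // i j; under eq_fun do rewrite mxE; exact: smooth_coord.
have oD := @open_det_neq0 R.
pose O := [set q | [set q : 'M[R]_3 | \det q != 0] q /\ K (T q)].
have oO : open O by exact: open_setI_preimage oD (sT _ oD) oK.
have gE a : K a -> (gam a)^T *m gam a = G + (m a)%:M.
  move=> Ka; rewrite /gam trmx_mul mulmxA -[_ *m Q^T *m _]mulmxA QQ mulmx1.
  by have [] := CE Ka.
have detg a : K a -> \det (gam a) != 0.
  by move=> Ka; rewrite /gam det_mulmx mulf_neq0 // (det_C_neq0 CE Ka).
have Tg a : K a -> T (gam a) = a.
  move=> Ka; rewrite /T gE // !mxE mulr1n /m; move: (G 0 0) => c.
  by field.
apply: rt_step; apply: (@ham_arc_curve _ lam mu lam0 mu0 s F FP K O gam T G m) => //.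
- apply: (smooth_mulmx oK); first exact: smooth_cst.
  apply: smooth_mx => // i j.
  apply: (@smooth_comp _ _ J K (fun a => C a i j) m) => //; last exact: sm.
  exact: smooth_entry.
- exact: sm.
- exact: sT.
- by move=> q [].
- by move=> q [].
- move=> a /andP[a0 a1].
  (* All intermediate heights lie above the smaller of [t] and [t'], and [J] is closed upwards. *)
  have Ka : K a.
    rewrite /K /= /m; have [le|lt] := leP t t'.
      by apply: Jup Jt _; rewrite lerDl mulr_ge0 // subr_ge0.
    apply: Jup Jt' _.
    have -> : t + a * d = t' + (1 - a) * (t - t') by rewrite /d; ring.
    by rewrite lerDl mulr_ge0 // subr_ge0 // ltW.
  split; last exact: Tg.
  by split; [exact: detg|rewrite Tg].
Qed.

(* The cyclic permutation matrix, i.e. the rotation by the quaternion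
   [(1 + i + j + k) / 2], lies in the image of all four Cayley charts. *)
Let Qc : 'M[R]_3 := \matrix_(i, j) nth 0 (nth [::]
  [:: [:: 0; 1; 0]; [:: 0; 0; 1]; [:: 1; 0; 0]] i) j.

(** Passing through [Qc] joins points of different charts: turn to [Qc] in one chart, change the
    height there, and turn away in the other chart. *)
Lemma gram_leaf_reach q q' : gram_leaf G e q -> gram_leaf G e q' -> reach q q'.
Proof.
rewrite (gram_leaf_cover CE Jmem) => -[k _ [u Uu <-]] [l _ [v Uv <-]].
have QQ : Qc^T *m Qc = 1%:M by rewrite /Qc; mx3; ring.
have dQ : \det Qc = 1 by rewrite /Qc det3 !mxE /=; ring.
have trQ n : \tr (flip n *m Qc) = 0.
  rewrite /mxtrace sum3 /flip /Qc; case: n => [|[|[|[|n]]]];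
    rewrite !(mxE, sum3) /= ?nth_nil ?mulr1n ?mulr0n; ring.
pose y n := cay_inv (flip n *m Qc).
have yE n t : chart C n (chart_point (y n) t) = Qc *m C t.
  rewrite /chart rot_chart_point height_chart_point cay_invK.
  - by rewrite mulmxA flipK mul1mx.
  - by rewrite trmx_mul flip_tr mulmxA -[_ *m flip n *m flip n]mulmxA flipK mulmx1.
  - by rewrite det_mulmx det_flip dQ mulr1.
  - by rewrite trQ addr0 oner_neq0.
have A1 : reach (chart C k u) (Qc *m C (height u)).
  by rewrite -(yE k) -{1}[u]chart_pointK; exact: rotation_arc.
have A2 : reach (Qc *m C (height u)) (Qc *m C (height v)) by exact: height_arc.
have A3 : reach (Qc *m C (height v)) (chart C l v).
  by rewrite -(yE l) -[X in reach _ (chart C l X)]chart_pointK; exact: rotation_arc.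
exact: rt_trans A1 (rt_trans _ _ _ _ _ A2 A3).
Qed.

Lemma reach_gram_leaf q q' : reach q q' -> gram_leaf G e q -> gram_leaf G e q'.
Proof.
elim=> [{}q {}q' qq' [dq [t tE]]|//|{}q q1 {}q' _ IH1 _ IH2 /IH1/IH2 //].
have [dq' [c cE]] := ham_arc_gram lam0 mu0 FP qq' dq.
by split=> //; exists (t + c); rewrite cE tE raddfD /= addrA.
Qed.

Lemma leaf_eq p : gram_leaf G e p -> [set q | reach p q] = gram_leaf G e.
Proof.
move=> pL; apply/seteqP; split => q /= qp; first exact: reach_gram_leaf qp pL.
exact: gram_leaf_reach.
Qed.

End LeafConnected.

(** * The atlas of a leaf and its hyperkähler structure *)

Section HyperkahlerLeaf.
Context {R : realType} (G : 'M[R]_3) (e : bool) (J : set R) (C : R -> 'M[R]_3).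
Context (oJ : open J) (sC : smooth_on J C)
  (CE : forall t, J t -> (C t)^T *m C t = G + t%:M /\ 0 < (-1) ^+ e * \det (C t))
  (Jmem : forall q t, \det q != 0 -> q^T *m q = G + t%:M -> J t).

Lemma scalar_hat_inj (a b : R) (y z : 'rV[R]_3) :
  a%:M + hat y = b%:M + hat z -> a = b /\ y = z.
Proof.
move=> E; have E' i j := congr1 (fun A : 'M[R]_3 => A i j) E.
split; first by have := E' 0 0; rewrite !mxE /= !mulr1n !addr0.
apply: row3P; [have := E' 2 1|have := E' 0 2|have := E' 1 0];
  by rewrite !mxE /= !mulr0n !add0r.
Qed.

Lemma chart_immersion k u : chart_dom J u -> injective (fun v => 'D_v (chart C k) u).
Proof.
move=> Uu v w /(congr1 (mulmx (chart C k u)^T)).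
rewrite !(chart_tangent oJ sC CE) // => /scalar_hat_inj[h z].
have := mul_frame_mx C u v; rewrite h z -mul_frame_mx.
exact: (can_inj (mulmxK (frame_mx_unit CE Uu))).
Qed.

Lemma chart_atlas : immersed_atlas (gram_leaf G e) (fun=> chart_dom J) (chart C).
Proof.
split.
- by move=> k; split; [exact: chart_dom_open|exact: smooth_chart].
- by move=> k u v; exact: chart_inj CE k u v.
- by move=> k u; exact: chart_immersion.
- exact: gram_leaf_cover.
- by move=> k l; exact: chart_transition CE k l.
Qed.

Context (lam mu : R) (lam0 : 0 < lam) (mu0 : 0 < mu) (s : bool).
Context (F : 'I_3 -> 'rV[R]_3) (FP : frame mu s F).

Lemma frame_cyc i : frame mu s (cyc F i).
Proof.
split=> [j k|]; first by rewrite /cyc FP.1 (inj_eq (addIr i)).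
have -> : \det (\matrix_j cyc F i j) = \det (\matrix_j F j); last exact: FP.2.
rewrite !det3 !mxE /cyc.
have a01 : 1 + 1 = 2 :> 'I_3 by exact/val_inj.
have a21 : 2 + 1 = 0 :> 'I_3 by exact/val_inj.
have a12 : 1 + 2 = 0 :> 'I_3 by exact/val_inj.
have a22 : 2 + 2 = 1 :> 'I_3 by exact/val_inj.
by elim/ord3P: i; rewrite ?addr0 ?add0r ?a01 ?a21 ?a12 ?a22; ring.
Qed.

Lemma chart_range k u : chart_dom J u ->
  range (fun v => 'D_v (chart C k) u) = range (piF_sharp lam mu F (chart C k u)).
Proof.
move=> Uu; have p0 := det_chart_neq0 CE k Uu; have Mu := frame_mx_unit CE Uu.
have pu : (chart C k u)^T \in unitmx by rewrite unitmx_tr unitmxE unitfE.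
apply/seteqP; split => [_ [v _ <-]|_ [al _ <-]].
  exists (flat mu F (chart C k u) (height v / 2) (zeta C u v)) => //.
  exact: (piF_sharp_flat lam0 mu0 FP p0 (chart_tangent oJ sC CE k v Uu)).
have [t [z tE]] := tangent_piF_sharp lam0 mu0 FP al p0.
exists (chart_point z t *m invmx (frame_mx C u)) => //.
set v := _ *m invmx _; apply: (can_inj (mulKmx pu)); rewrite tE (chart_tangent oJ sC CE) //.
have := mul_frame_mx C u v; rewrite /v mulmxKV // -/v => E.
have := congr1 (@rot_part R) E; rewrite !rot_chart_point => ->.
by have := congr1 (@height R) E; rewrite !height_chart_point => <-.
Qed.

Let W (i : 'I_3) k := leaf_form_mx lam mu (cyc F i) (chart C k).
Let c u := 4 * mu / \det (C (height u)).

Let c_neq0 u : chart_dom J u -> c u != 0.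
Proof.
move=> Uu; rewrite mulf_neq0 ?invr_neq0 ?(det_C_neq0 CE Uu) //.
by rewrite mulf_neq0 ?gt_eqF.
Qed.

Let WE i k u : chart_dom J u ->
  W i k u = c u *: (frame_mx C u *m quat_form (F i) *m (frame_mx C u)^T).
Proof.
by move=> Uu; rewrite /W (leaf_form_mxE oJ sC CE lam0 mu0 (frame_cyc i)) // /cyc add0r.
Qed.

Let r_neq0 : (8 * mu)^-1 != 0. Proof. by rewrite gt_eqF // normsq_gt0. Qed.

Lemma chart_hypersymplectic : hypersymplectic (fun=> chart_dom J) W.
Proof.
have fE i j := dot_frame mu0 FP i j.
split=> [i k|i j k u ij Uu /=].
  have [sW cW] := leaf_form_closed oJ sC CE lam0 mu0 (frame_cyc i) k.
  split=> // u Uu; rewrite WE //; first exact: form_antisym.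
  exact: (form_unit r_neq0 (c_neq0 Uu) (frame_mx_unit CE Uu) fE).
rewrite !WE //.
exact: (form_sq r_neq0 (c_neq0 Uu) (frame_mx_unit CE Uu) fE ij).
Qed.

Lemma chart_hyperkahler : hyperkahler (fun=> chart_dom J) W.
Proof.
have fE i j := dot_frame mu0 FP i j.
split; first exact: chart_hypersymplectic.
pose phi := \det (\matrix_j F j).
have gE k u : chart_dom J u ->
    pseudo_metric W k u = (c u * phi / (8 * mu)^-1) *: (frame_mx C u *m (frame_mx C u)^T).
  move=> Uu; rewrite /pseudo_metric !WE //; have [fx _ _] := cross_frame mu0 FP.
  exact: (form_metric r_neq0 (c_neq0 Uu) (frame_mx_unit CE Uu) fE fx).
have sgn u : chart_dom J u -> 0 < (-1) ^+ e * (-1) ^+ s * (c u * phi / (8 * mu)^-1).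
  move=> Uu; have [_ dC] := CE Uu; have fs := FP.2; rewrite -/phi in fs.
  have -> : (-1) ^+ e * (-1) ^+ s * (c u * phi / (8 * mu)^-1) =
      ((-1) ^+ s * phi) * (4 * mu * (8 * mu)) / ((-1) ^+ e * \det (C (height u))).
    have ee : ((-1) ^+ e)^-1 = (-1) ^+ e :> R by rewrite invr_sign.
    by rewrite /c invrK invfM ee; ring.
  by apply: divr_gt0 => //; apply: mulr_gt0 => //; rewrite !mulr_gt0.
(* The sign of the metric combines the sign of the determinant on the leaf with the orientation of
   the frame, hence is the same at all points. *)
have [es|es] := boolP (e == s); [left|right] => k u Uu; rewrite gE //;
  have := sgn u Uu; have Mu := frame_mx_unit CE Uu.
  rewrite (eqP es) -expr2 sqrr_sign mul1r => k0; exact: posdef_gram.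
have -> : (-1) ^+ e * (-1) ^+ s = -1 :> R.
  by move: es; case: (e); case: (s) => //= _; rewrite expr1 expr0 ?mulr1 ?mul1r.
rewrite mulN1r => k0; rewrite -scaleNr; exact: posdef_gram.
Qed.

End HyperkahlerLeaf.

Theorem theorem4p7 (R : realType) (lam mu : R) (s : bool) (S : set 'M[R]_3) :
  0 < lam -> 0 < mu ->
  hypersymplectic_leaf lam mu s S -> hyperkahler_leaf lam mu s 4 S.
Proof.
move=> lam0 mu0 [F0 F0P [p pM ->]].
pose G := p^T *m p; pose e := \det p < 0.
have GT : G^T = G by rewrite trmx_mul trmxK.
have [J [C [oJ Jup sC CE Jmem]]] := exists_sqrt_curve e GT.
(* The base point has height 0. [gram_leaf] and its charts do not mention [F0], so one atlas serves
   all frames below. *)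
rewrite (leaf_eq oJ Jup sC CE Jmem lam0 mu0 F0P); last first.
  split; last by exists 0; rewrite raddf0 addr0.
  by rewrite -normrEsign normr_gt0; move: pM; rewrite (MoE lam0 mu0 F0P).
exists (fun=> chart_dom J), (chart C); split; first exact: chart_atlas.
move=> F FP; split; last exact: (chart_hyperkahler oJ sC CE lam0 mu0 FP).
by move=> i k u Uu; exact: (chart_range oJ sC CE lam0 mu0 (frame_cyc FP i) k Uu).
Qed.
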